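(* Let $r\ge 1$, let $P_1,\ldots,P_r\in\mathbb{C}[z]$ be polynomials such that $P_j-P_k$ is non-constant for any $j\neq k$, let $d_j:=\deg(P_j)$ and let $f_j(z):=e^{P_j(z)}$ for $z\in\mathbb{C}$, $1\le j\le r$. Let $g_{jk}\in\mathcal{M}_{<1}$ for all $1\le j,k\le r$ be such that $$D(z):=\det\big(g_{jk}(z)\big)_{j,k}\neq 0\quad\text{for all } z\in A,$$ where $A\subset\mathbb{C}$ is a non-discrete subset. Then the meromorphic functions $h_j:=\sum_{k=1}^r g_{jk}f_k$, $1\le j\le r$, are linearly independent over $\mathcal{M}_{<1}$. Moreover, if in addition $d_j\ge 1$ for all $1\le j\le r$ and $|\{d_1,\ldots,d_r\}|=r$ (that is, the degrees are pairwise distinct), then $h_1,\ldots,h_r$ are algebraically independent over $\mathcal{M}_{<1}$.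
   Context: An entire function $g$ has order of growth $\le\rho$ (for a real number $\rho>0$) if there are constants $A,B>0$ such that $|g(z)|\le Ae^{B|z|^{\rho}}$ for all $z\in\mathbb{C}$; its order of growth is $\rho(g)=\inf\{\rho>0 : g \text{ has order of growth}\le\rho\}$. $\mathcal{O}_{<1}$ denotes the domain of entire functions with order of growth $<1$, and $\mathcal{M}_{<1}$ denotes its quotient field, i.e. the field of meromorphic functions on $\mathbb{C}$ of order $<1$, viewed as a subfield of the field of all meromorphic functions on $\mathbb{C}$. *)

(* Defs.v *)
From HB Require Import structures.
From mathcomp Require Import all_boot all_order all_algebra.
From mathcomp Require Import complex.
From mathcomp Require Import all_classical all_reals all_analysis.
From mathcomp Require mpoly.
Import -(notations) mpoly. (* its notations clash with mathcomp-analysis *)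
Set Implicit Arguments.
Unset Strict Implicit.
Unset Printing Implicit Defensive.
Import Order.TTheory GRing.Theory Num.Theory.
Import numFieldNormedType.Exports.
Local Open Scope classical_set_scope.
Local Open Scope complex_scope.
Local Open Scope ring_scope.

(* The complex numbers, kept behind a constant of type numFieldType because that
   is the type on which the library puts the norm topology (R[i] itself has
   none). *)
Definition Cplx (R : realType) : numFieldType := R[i].

Section Defs.
Variable R : realType.
Local Notation C := (Cplx R).
Implicit Types (f g : C -> C) (z : C).

(* `|z| lives in C; cabs z is the same modulus as an element of R. *)
Definition cabs z : R := complex.Re (`|z| : R[i]).

Definition cexp z : C :=
  let: x +i* y := (z : R[i]) in (expR x)%:C * (cos y +i* sin y).

(* Complex differentiability: derivable is taken over the scalar field C. *)
Definition entire g : Prop := forall z, derivable g z 1.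

Definition growth_le g (rho : R) : Prop :=
  exists A B : R, [/\ 0 < A, 0 < B &
    forall z, cabs (g z) <= A * expR (B * cabs z `^ rho)].

Definition growth_order g : \bar R :=
  ereal_inf [set rho%:E | rho in [set rho : R | 0 < rho /\ growth_le g rho]].

Definition entire_lt1 g : Prop := entire g /\ (growth_order g < 1%:E)%E.

(* A meromorphic function is represented by a total function C -> C
   whose values on a closed discrete set (in particular at the poles) carry no
   meaning; [mero_eq] is equality in the field of meromorphic functions. *)
Definition meromorphic f : Prop :=
  forall z0, exists (n : nat) (F : C -> C),
    (\forall z \near z0, derivable F z 1) /\
    (\forall z \near z0^', (z - z0) ^+ n * f z = F z).

Definition mero_eq f g : Prop := forall z0, \forall z \near z0^', f z = g z.

Definition mero_lt1 f : Prop :=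
  meromorphic f /\
  exists p q : C -> C, [/\ entire_lt1 p, entire_lt1 q,
    (exists z, q z != 0) & mero_eq f (fun z => p z / q z)].

(* "Discrete" is meant as in the identity theorem (no accumulation point in the
   plane); a set with a non-isolated point is in particular nondiscrete. *)
Definition nondiscrete (A : set C) : Prop := limit_point A !=set0.

Definition lin_indep_mero_lt1 (r : nat) (h : 'I_r -> C -> C) : Prop :=
  forall a : 'I_r -> C -> C, (forall j, mero_lt1 (a j)) ->
    mero_eq (\sum_(j < r) a j * h j) 0 -> forall j, mero_eq (a j) 0.

(* Polynomials with coefficients in the ring of functions C -> C (with
   pointwise operations); such a polynomial is the zero polynomial over the
   field of meromorphic functions when all its coefficients are [mero_eq] 0. *)
Definition alg_indep_mero_lt1 (r : nat) (h : 'I_r -> C -> C) : Prop :=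
  forall p : mpoly r (C -> C),
    (forall m, mero_lt1 (mcoeff m p)) ->
    mero_eq (meval h p) 0 -> forall m, mero_eq (mcoeff m p) 0.

End Defs.

(* Main.v *)
Require Import Defs.
From HB Require Import structures.
From mathcomp Require Import all_boot all_order all_algebra.
From mathcomp Require Import complex.
From mathcomp Require Import all_classical all_reals all_analysis.
From mathcomp Require mpoly.
Import -(notations) mpoly.
From mathcomp Require Import ring lra.
Set Implicit Arguments.
Unset Strict Implicit.
Unset Printing Implicit Defensive.
Import Order.TTheory GRing.Theory Num.Theory.
Import numFieldNormedType.Exports.
Local Open Scope classical_set_scope.
Local Open Scope complex_scope.
Local Open Scope ring_scope.

(** Write M for the field of meromorphic functions of order less than 1.

    Everything rests on one fact: exponentials of polynomials that differ pairwise
    by non-constant polynomials are linearly independent over M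
    ([exponentials_independent]). Clearing denominators, let sum_k b_k e^(P_k) = 0
    with entire b_k of order less than 1. Along a generic ray the real parts of
    the P_k with b_k <> 0 are strictly ordered, with gaps that grow at least
    linearly, and this persists in a cone around the ray. If P_k is the largest,
    the relation forces |b_k(z)| <= A e^(- c |z|) in that cone. But an entire
    function b of order less than 1 that decays exponentially in a cone is zero
    ([cone_decay_eq0]): there are finitely many maps z |-> z0 + w z such that
    each point far away is sent into the cone by one of them, and in the product
    of the functions b(z0 + w z) this one tiny factor beats the growth of all
    others, so the value b(z0)^N at the centre is 0 by the maximum principle. The growth
    condition is used in the form |b(z)| <= A_eta e^(eta |z|) for every eta > 0.

    The function theory needed is a maximum principle, and a version with the
    constant 2 is enough ([center_le_twice_annulus]). It follows from Goursat's
    theorem for (F(z) - F(0)) / z on squares, which is proved by bisection from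
    complex differentiability alone. The principle also gives the identity theorem
    for functions of subexponential growth: if F vanishes at n points near the
    centre, apply it to F^2 divided by the polynomial with these roots, and let n
    grow ([entire_subexp_isolated_zeros]). So the quotients form a field.

    For the first claim, a relation sum_j a_j h_j = 0 reads
    sum_k (sum_j a_j g_jk) e^(P_k) = 0, so the row vector (a_j) is annihilated by
    the matrix (g_jk), whose determinant vanishes only at isolated points since it
    is nonzero on a set with an accumulation point. For the second claim, the
    linear change of variables with matrix (g_jk) turns a polynomial relation
    between the h_j into one between the f_k. A monomial in the f_k is the
    exponential of sum_k m_k P_k, and distinct exponents m give non-constant
    differences because the degrees of the P_k are distinct and positive
    ([size_sum_distinct_degrees]). So all coefficients vanish after the change of
    variables, and it can be undone by the adjugate matrix, at the cost of powers
    of the determinant ([mcoeff_linear_change_eq0]). *)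

(** * Complex numbers and their real modulus *)

Section ComplexNumbers.
Variable R : realType.
Local Notation C := (Cplx R).
Implicit Types (z w : C) (x y : R).

Definition re z : R := complex.Re z.
Definition im z : R := complex.Im z.
Definition mkC x y : C := Complex x y.
Definition rC x : C := mkC x 0.

Lemma C_ext z w : re z = re w -> im z = im w -> z = w.
Proof. by case: z => a b; case: w => c d; rewrite /re /im /= => -> ->. Qed.

Lemma re_mk x y : re (mkC x y) = x. Proof. by []. Qed.
Lemma im_mk x y : im (mkC x y) = y. Proof. by []. Qed.
Lemma re0 : re 0 = 0. Proof. by []. Qed.
Lemma im0 : im 0 = 0. Proof. by []. Qed.
Lemma re1 : re 1 = 1. Proof. by []. Qed.
Lemma im1 : im 1 = 0. Proof. by []. Qed.
Lemma reD z w : re (z + w) = re z + re w. Proof. by case: z; case: w. Qed.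
Lemma imD z w : im (z + w) = im z + im w. Proof. by case: z; case: w. Qed.
Lemma reN z : re (- z) = - re z. Proof. by case: z. Qed.
Lemma imN z : im (- z) = - im z. Proof. by case: z. Qed.
Lemma reB z w : re (z - w) = re z - re w. Proof. by rewrite reD reN. Qed.
Lemma imB z w : im (z - w) = im z - im w. Proof. by rewrite imD imN. Qed.
Lemma reM z w : re (z * w) = re z * re w - im z * im w.
Proof. by case: z; case: w. Qed.
Lemma imM z w : im (z * w) = re z * im w + im z * re w.
Proof. by case: z; case: w. Qed.

Definition reimE := (re_mk, im_mk, re0, im0, re1, im1, reB, imB, reD, imD,
  reN, imN, reM, imM).

Lemma rC0 : rC 0 = 0. Proof. by []. Qed.
Lemma rCD x y : rC (x + y) = rC x + rC y.
Proof. by apply: C_ext; rewrite /rC !reimE ?addr0. Qed.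
Lemma rCM x y : rC (x * y) = rC x * rC y.
Proof. by apply: C_ext; rewrite /rC !reimE; ring. Qed.

Lemma norm_cabs z : `|z| = rC (cabs z) :> C.
Proof. by rewrite /cabs; case: z => a b; rewrite normc_def. Qed.

Lemma cabsE z : cabs z = Num.sqrt (re z ^+ 2 + im z ^+ 2).
Proof. by rewrite /cabs normc_def. Qed.

Lemma rC_le x y : (rC x <= rC y) = (x <= y). Proof. exact: lecR. Qed.
Lemma rC_lt x y : (rC x < rC y) = (x < y). Proof. exact: ltcR. Qed.

Lemma rC_inj : injective rC. Proof. by move=> x y; case. Qed.

Lemma cabs_ge0 z : 0 <= cabs z. Proof. by rewrite cabsE sqrtr_ge0. Qed.
Lemma cabs0 : cabs (0 : C) = 0.
Proof. by rewrite cabsE !reimE expr0n addr0 sqrtr0. Qed.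
Lemma cabs1 : cabs (1 : C) = 1.
Proof. by apply: rC_inj; rewrite -norm_cabs normr1. Qed.
Lemma cabs_eq0 z : (cabs z == 0) = (z == 0).
Proof. by rewrite -(inj_eq rC_inj) -norm_cabs normr_eq0. Qed.
Lemma cabs_gt0 z : (0 < cabs z) = (z != 0).
Proof. by rewrite lt_neqAle cabs_ge0 andbT eq_sym cabs_eq0. Qed.
Lemma cabsN z : cabs (- z) = cabs z.
Proof. by apply: rC_inj; rewrite -!norm_cabs normrN. Qed.
Lemma cabsM z w : cabs (z * w) = cabs z * cabs w.
Proof. by apply: rC_inj; rewrite rCM -!norm_cabs normrM. Qed.
Lemma cabsD z w : cabs (z + w) <= cabs z + cabs w.
Proof. by rewrite -rC_le rCD -!norm_cabs ler_normD. Qed.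
Lemma cabsB z w : cabs (z - w) <= cabs z + cabs w.
Proof. by rewrite (le_trans (cabsD _ _))// cabsN. Qed.
Lemma cabs_subl z w : cabs z - cabs w <= cabs (z - w).
Proof. by rewrite lerBlDr (le_trans _ (cabsD _ _))// subrK. Qed.
Lemma cabsX z n : cabs (z ^+ n) = cabs z ^+ n.
Proof. by elim: n => [|n IH]; rewrite ?cabs1// !exprS cabsM IH. Qed.
Lemma cabs_prod (I : Type) (s : seq I) (F : I -> C) :
  cabs (\prod_(i <- s) F i) = \prod_(i <- s) cabs (F i).
Proof. by elim/big_rec2: _ => [|i x y _ <-]; rewrite ?cabs1 ?cabsM. Qed.
Lemma cabs_sum (I : Type) (s : seq I) (Q : pred I) (F : I -> C) :
  cabs (\sum_(i <- s | Q i) F i) <= \sum_(i <- s | Q i) cabs (F i).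
Proof.
elim/big_rec2: _ => [|i x y _ h]; first by rewrite cabs0.
by rewrite (le_trans (cabsD _ _))// lerD2l.
Qed.
Lemma cabsV z : cabs z^-1 = (cabs z)^-1.
Proof.
have [->|z0] := eqVneq z 0; first by rewrite invr0 cabs0 invr0.
have h : cabs z * cabs z^-1 = 1 by rewrite -cabsM divff// cabs1.
by apply: (mulfI (lt0r_neq0 (_ : 0 < cabs z))); rewrite ?cabs_gt0// h divff// cabs_eq0.
Qed.
Lemma cabs_rC x : cabs (rC x) = `|x|.
Proof. by rewrite cabsE !reimE expr0n addr0 sqrtr_sqr. Qed.

Lemma cabs_i : cabs ('i : C) = 1.
Proof. by rewrite cabsE /= expr0n expr1n add0r sqrtr1. Qed.

Lemma re_le_cabs z : `|re z| <= cabs z.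
Proof.
by rewrite cabsE -sqrtr_sqr ler_wsqrtr// lerDl sqr_ge0.
Qed.
Lemma im_le_cabs z : `|im z| <= cabs z.
Proof.
by rewrite cabsE -sqrtr_sqr ler_wsqrtr// lerDr sqr_ge0.
Qed.
Lemma cabs_le_reim z : cabs z <= `|re z| + `|im z|.
Proof.
rewrite cabsE -[leRHS]ger0_norm ?addr_ge0// -sqrtr_sqr ler_wsqrtr//.
rewrite sqrrD !real_normK ?num_real// -addrA lerD2l lerDr.
by rewrite mulrn_wge0// mulr_ge0.
Qed.

End ComplexNumbers.

(** * Primitives of continuous functions *)

Section RealCalculus.
Variable R : realType.
Local Notation C := (Cplx R).

Lemma MVT_everywhere (f df : R -> R) (a b : R) : a < b ->
  (forall t, is_derive t (1 : R) f (df t)) ->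
  exists2 c, a <= c <= b & f b - f a = df c * (b - a).
Proof.
move=> ab fd.
have cf : {within `[a, b], continuous f}.
  by apply: derivable_within_continuous => t _; apply: ex_derive.
have [c cab ->] := MVT ab (fun t _ => fd t) cf.
by exists c => //; move: cab; rewrite in_itv /= => /andP[/ltW-> /ltW->].
Qed.

Lemma is_derive_subcst (F : R -> R) (c x l : R) :
  is_derive x (1 : R) F l -> is_derive x (1 : R) (F - cst c) l.
Proof. by move=> dF; apply: is_derive_eq; rewrite subr0. Qed.

Lemma is_derive_diff0 (F G : R -> R) (x l : R) :
  is_derive x (1 : R) F l -> is_derive x (1 : R) G l ->
  is_derive x (1 : R) (F - G) 0.
Proof. by move=> dF dG; apply: is_derive_eq; rewrite subrr. Qed.

(** The library integrates from a fixed left end, hence the lower bound - 1. *)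
Lemma FTC_right (f : R -> R) (cf : continuous f) :
  let F := fun x : R => \int[lebesgue_measure]_(t in [set` `[-1, x]]) f t in
  forall x : R, -1 < x -> is_derive x (1 : R) F (f x).
Proof.
move=> F x x1.
have xx1 : x < x + 1 by rewrite ltrDl.
have fi : lebesgue_measure.-integrable [set` `[-1, x + 1]] (EFin \o f).
  apply: continuous_compact_integrable; first exact: segment_compact.
  by apply: continuous_subspaceT => y; apply: cf.
have [dF <-] := continuous_FTC1_closed xx1 fi x1 (cf x).
by rewrite derive1E; apply: derivableP.
Qed.

(** The primitive from the left end - 1 and its mirror image cover the two half
    lines; they overlap on ]-1, 1[, where they differ by a constant, and are glued
    at 0. *)
Lemma primitive_exists (f : R -> R) : continuous f ->
  exists F : R -> R, forall x, is_derive x (1 : R) F (f x).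
Proof.
move=> cf.
pose F1 := fun x : R => \int[lebesgue_measure]_(t in [set` `[-1, x]]) f t.
have F1d : forall x : R, -1 < x -> is_derive x (1 : R) F1 (f x) by exact: FTC_right.
pose fN := fun x : R => f (- x).
have cfN : continuous fN.
  by move=> x; apply: continuous_comp; [exact: opp_continuous | exact: cf].
pose F2 := fun x : R => \int[lebesgue_measure]_(t in [set` `[-1, x]]) fN t.
have F2d : forall x : R, -1 < x -> is_derive x (1 : R) F2 (fN x) by exact: FTC_right.
pose F3 := - (F2 \o -%R).
have F3d (x : R) : x < 1 -> is_derive x (1 : R) F3 (f x).
  move=> x1; have x1' : -1 < - x by rewrite ltrN2.
  have /is_deriveN := is_derive1_comp (F2d _ x1') (is_deriveNid x 1).
  by rewrite /fN opprK mulrN1 opprK.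
pose G1 := F1 - cst (F1 0); pose G3 := F3 - cst (F3 0).
have G1d (x : R) : -1 < x -> is_derive x (1 : R) G1 (f x).
  by move=> x1; exact: (is_derive_subcst _ (F1d x x1)).
have G3d (x : R) : x < 1 -> is_derive x (1 : R) G3 (f x).
  by move=> x1; exact: (is_derive_subcst _ (F3d x x1)).
have eG (x : R) : -1 < x -> x <= 0 -> G3 x = G1 x.
  move=> x1 x0; apply/eqP; rewrite -subr_eq0; apply/eqP.
  have e0 : (G3 - G1) 0 = 0 by rewrite /G3 /G1 !fctE !subrr.
  move: x0; rewrite le_eqVlt => /orP[/eqP->//|x0].
  have dd (t : R) : -1 < t -> t < 1 -> is_derive t (1 : R) (G3 - G1) 0.
    by move=> t1 t2; exact: (is_derive_diff0 (G3d t t2) (G1d t t1)).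
  have hd (t : R) : t \in `]x, 0[ -> is_derive t (1 : R) (G3 - G1) 0.
    rewrite in_itv /= => /andP[h1 h2].
    by apply: dd; [exact: lt_trans h1 | exact: lt_trans h2 ltr01].
  have hc : {within `[x, 0], continuous (G3 - G1)}.
    apply: derivable_within_continuous => t; rewrite in_itv /= => /andP[h1 h2].
    have [//] := dd t (lt_le_trans x1 h1) (le_lt_trans h2 ltr01).
  have [c _] := MVT x0 hd hc.
  by rewrite mul0r e0 sub0r => /eqP; rewrite oppr_eq0 => /eqP.
exists (fun x : R => if 0 <= x then G1 x else G3 x) => x.
have [x0|x0] := ltP x 0.
  apply: (near_eq_is_derive (f := G3)); last first.
    by apply: G3d; apply: lt_trans ltr01.
  near=> t; rewrite leNgt ifF//; apply/negbF.
  near: t; exact: lt_nbhsl.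
apply: (near_eq_is_derive (f := G1)); last first.
  by apply: G1d; apply: lt_le_trans x0; rewrite ltrN10.
near=> t; case: (leP 0 t) => // t0; rewrite eG// ?(ltW t0)//.
near: t; apply: lt_nbhsr; apply: lt_le_trans x0; rewrite ltrN10.
Unshelve. all: by end_near. Qed.

End RealCalculus.

(** * Bisection of rectangles *)

Section Bisection.
Variable R : realType.

Lemma nested_intervals (u v : nat -> R) :
  (forall n, u n <= u n.+1) -> (forall n, v n.+1 <= v n) ->
  (forall n, u n <= v n) -> exists a, forall n, u n <= a <= v n.
Proof.
move=> hu hv huv.
have um m n : (m <= n)%N -> u m <= u n.
  by elim: n => [|n IH]; rewrite leq_eqVlt => /predU1P[->//|//] /IH/le_trans; exact.
have vm m n : (m <= n)%N -> v n <= v m.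
  elim: n => [|n IH]; rewrite leq_eqVlt => /predU1P[->//|//] /IH; exact: le_trans.
have uv m n : u m <= v n.
  apply: (le_trans (um _ _ (leq_maxl m n))); apply: (le_trans (huv _)).
  by apply/vm/leq_maxr.
exists (sup (range u)) => n; apply/andP; split.
  apply: ub_le_sup; last by exists n.
  by exists (v 0%N) => _ [m _ <-].
apply: ge_sup; first by exists (u 0%N), 0%N.
by move=> _ [m _ <-].
Qed.

(** A compactness principle for rectangles: a property that passes from the four
    quarters of a rectangle to the rectangle, and that holds for all small
    rectangles around each point, is global. *)
Lemma rectangle_bisection (P : R -> R -> R -> R -> Prop) (x0 y0 s0 t0 : R) :
  (forall x y s t, P x y s t -> P (x + s) y s t -> P x (y + t) s t ->
    P (x + s) (y + t) s t -> P x y (s *+ 2) (t *+ 2)) ->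
  0 <= s0 -> 0 <= t0 ->
  (forall a b, x0 <= a <= x0 + s0 -> y0 <= b <= y0 + t0 ->
    exists2 dlt, 0 < dlt & forall x y s t, s < dlt -> t < dlt ->
      x <= a <= x + s -> y <= b <= y + t -> P x y s t) ->
  P x0 y0 s0 t0.
Proof.
move=> Psub s0_ge0 t0_ge0 Ploc; apply: contrapT => nP.
(* The corner of a quarter of the rectangle at q on which P fails. *)
pose step (q : R * R) (s t : R) : R * R :=
  if `[< ~ P q.1 q.2 s t >] then q else
  if `[< ~ P (q.1 + s) q.2 s t >] then (q.1 + s, q.2) else
  if `[< ~ P q.1 (q.2 + t) s t >] then (q.1, q.2 + t) else (q.1 + s, q.2 + t).
have stepP q s t : ~ P q.1 q.2 (s *+ 2) (t *+ 2) ->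
    ~ P (step q s t).1 (step q s t).2 s t.
  move=> h; rewrite /step; case: asboolP => // h1; case: asboolP => // h2.
  case: asboolP => // h3 h4; apply: h; apply: Psub => //; exact: contrapT.
have step1 q s t : 0 <= s -> q.1 <= (step q s t).1 <= q.1 + s.
  by move=> s_ge0; rewrite /step; do 3?case: ifP => _ //=; rewrite ?lexx ?lerDl ?s_ge0.
have step2 q s t : 0 <= t -> q.2 <= (step q s t).2 <= q.2 + t.
  by move=> s_ge0; rewrite /step; do 3?case: ifP => _ //=; rewrite ?lexx ?lerDl ?s_ge0.
pose h n : R := (2 ^+ n)^-1.
have h0 n : 0 < h n by rewrite invr_gt0 exprn_gt0.
have hS n : h n.+1 *+ 2 = h n.
  by rewrite /h exprS invfM -mulrnAl -mulr_natr mulVf ?mul1r ?pnatr_eq0.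
pose q := fix q n :=
  if n is m.+1 then step (q m) (s0 * h m.+1) (t0 * h m.+1) else (x0, y0).
have nPq n : ~ P (q n).1 (q n).2 (s0 * h n) (t0 * h n).
  elim: n => [|n IH] /=; first by rewrite /h expr0 invr1 !mulr1.
  by apply: stepP; rewrite -!mulrnAr hS.
have q1 n : (q n).1 <= (q n.+1).1 <= (q n).1 + s0 * h n.+1.
  by apply: step1; rewrite mulr_ge0// ltW.
have q2 n : (q n).2 <= (q n.+1).2 <= (q n).2 + t0 * h n.+1.
  by apply: step2; rewrite mulr_ge0// ltW.
have [a aP] : exists a, forall n, (q n).1 <= a <= (q n).1 + s0 * h n.
  apply: nested_intervals => n; first by case/andP: (q1 n).
    case/andP: (q1 n) => _; rewrite -(hS n) mulrnAr mulr2n => ?; lra.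
  by rewrite lerDl mulr_ge0// ltW.
have [b bP] : exists b, forall n, (q n).2 <= b <= (q n).2 + t0 * h n.
  apply: nested_intervals => n; first by case/andP: (q2 n).
    case/andP: (q2 n) => _; rewrite -(hS n) mulrnAr mulr2n => ?; lra.
  by rewrite lerDl mulr_ge0// ltW.
have [||d d0 dP] := Ploc a b.
- by have := aP 0%N; rewrite /= /h expr0 invr1 mulr1.
- by have := bP 0%N; rewrite /= /h expr0 invr1 mulr1.
have [n nd] : exists n, (s0 + t0) * h n < d.
  exists (Num.bound ((s0 + t0) / d)).
  rewrite /h ltr_pdivrMr ?exprn_gt0// mulrC -ltr_pdivrMr//.
  apply: (lt_trans (archi_boundP _)); first by rewrite divr_ge0 ?addr_ge0// ltW.
  by rewrite -natrX ltr_nat ltn_expl.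
apply: (nPq n); apply: dP => //; move: nd; rewrite mulrDl; apply: le_lt_trans.
- by rewrite lerDl mulr_ge0// ltW.
- by rewrite lerDr mulr_ge0// ltW.
Qed.

End Bisection.

(** * Goursat's theorem on rectangles *)

Section Goursat.
Variable R : realType.
Local Notation C := (Cplx R).

(** Continuity and complex differentiability with a real epsilon, the form in
    which the estimates of this part consume them. *)
Definition ccont (F : C -> C) z := forall e, 0 < e -> exists2 d, 0 < d &
  forall w : C, cabs (w - z) < d -> cabs (F w - F z) < e.

Definition cdiff (F : C -> C) z l := forall e, 0 < e -> exists2 d, 0 < d &
  forall w : C, cabs (w - z) < d ->
    cabs (F w - F z - l * (w - z)) <= e * cabs (w - z).

Lemma ccont_of_cdiff (F : C -> C) z l : cdiff F z l -> ccont F z.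
Proof.
move=> dl e e0; have [d d0 hd] := dl 1 ltr01.
pose k := 1 + cabs l; have k0 : 0 < k by rewrite ltr_pwDl// cabs_ge0.
exists (Num.min d (e / k)); first by rewrite lt_min d0 divr_gt0.
move=> w; rewrite lt_min => /andP[/hd h]; rewrite ltr_pdivlMr// mulrC.
apply: le_lt_trans.
rewrite -[F w - F z](subrK (l * (w - z))); apply: (le_trans (cabsD _ _)).
by rewrite mulrDl cabsM lerD2r.
Qed.

(** phi is a primitive of the complex-valued function g of a real variable. *)
Definition cprim (phi g : R -> C) := forall t,
  is_derive t (1 : R) (fun s => re (phi s)) (re (g t)) /\
  is_derive t (1 : R) (fun s => im (phi s)) (im (g t)).

Lemma cprim_exists (g : R -> C) :
  (forall t e, 0 < e -> exists2 d, 0 < d &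
    forall s, `|s - t| < d -> cabs (g s - g t) < e) ->
  exists phi, cprim phi g.
Proof.
move=> cg.
have cre : continuous (fun t => re (g t)).
  move=> t; apply/cvgrPdist_lt => e e0; have [d d0 hd] := cg t e e0.
  apply/nbhs_ballP; exists d => //= s; rewrite /ball /= distrC => /hd.
  by apply: le_lt_trans; rewrite distrC -reB re_le_cabs.
have cim : continuous (fun t => im (g t)).
  move=> t; apply/cvgrPdist_lt => e e0; have [d d0 hd] := cg t e e0.
  apply/nbhs_ballP; exists d => //= s; rewrite /ball /= distrC => /hd.
  by apply: le_lt_trans; rewrite distrC -imB im_le_cabs.
have [f1 h1] := primitive_exists cre; have [f2 h2] := primitive_exists cim.
by exists (fun t => mkC (f1 t) (f2 t)) => t; split; [exact: h1 | exact: h2].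
Qed.

(** The mean value theorem holds only for each coordinate, whence the factor 2. *)
Lemma cprim_bound (phi g : R -> C) a b m : cprim phi g -> a <= b ->
  (forall t, a <= t <= b -> cabs (g t) <= m) ->
  cabs (phi b - phi a) <= (m * (b - a)) *+ 2.
Proof.
move=> hp; rewrite le_eqVlt => /predU1P[<- _|ab hm].
  by rewrite !subrr cabs0 mulr0 mul0rn.
have [c1 c1ab e1] := MVT_everywhere ab (fun t => (hp t).1).
have [c2 c2ab e2] := MVT_everywhere ab (fun t => (hp t).2).
have ab0 : 0 <= b - a by rewrite subr_ge0 ltW.
apply: (le_trans (cabs_le_reim _)).
rewrite reB imB e1 e2 !normrM (ger0_norm ab0) mulr2n lerD// ler_wpM2r//.
  exact: le_trans (re_le_cabs _) (hm _ _).
exact: le_trans (im_le_cabs _) (hm _ _).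
Qed.

Lemma cprimB (phi psi g h : R -> C) : cprim phi g -> cprim psi h ->
  cprim (fun t => phi t - psi t) (fun t => g t - h t).
Proof.
move=> p1 p2 t; rewrite reB imB; have [a1 b1] := p1 t; have [a2 b2] := p2 t.
have -> : (fun s => re (phi s - psi s)) =
  (fun s => re (phi s)) - (fun s => re (psi s)).
  by apply/funext => s; rewrite reB.
have -> : (fun s => im (phi s - psi s)) =
  (fun s => im (phi s)) - (fun s => im (psi s)).
  by apply/funext => s; rewrite imB.
by split; apply: is_deriveB.
Qed.

Lemma is_derive_quadratic (c0 c1 c2 t : R) :
  is_derive t (1 : R) (fun s => c0 + c1 * s + c2 * s ^+ 2) (c1 + c2 * t *+ 2).
Proof.
have d1 := is_derive_id t (1 : R).
have dc c := is_derive_cst (c : R) t (1 : R).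
have d2 := is_deriveD (is_deriveD (dc c0) (is_deriveM (dc c1) d1))
  (is_deriveM (dc c2) (is_deriveM d1 d1)).
apply: (is_derive_eq d2); rewrite /GRing.scale /=; ring.
Qed.

(** Along any line t |-> e t + k the affine function a + 2 b z has the primitive
    a z + b z^2; as this primitive does not depend on the line, the integral of an
    affine function along a closed polygon vanishes. *)
Lemma cprim_affine (a b e k : C) :
  cprim (fun t => a * (e * rC t + k) + b * (e * rC t + k) ^+ 2)
        (fun t => e * (a + b * (e * rC t + k) *+ 2)).
Proof.
move=> t.
pose c0 := a * k + b * k ^+ 2; pose c1 := a * e + b * e * k *+ 2.
pose c2 := b * e ^+ 2.
have E s : a * (e * rC s + k) + b * (e * rC s + k) ^+ 2 =
  c0 + c1 * rC s + c2 * rC s ^+ 2 by rewrite /c0 /c1 /c2; ring.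
split.
- have -> : (fun s => re (a * (e * rC s + k) + b * (e * rC s + k) ^+ 2)) =
    (fun s => re c0 + re c1 * s + re c2 * s ^+ 2).
    by apply/funext => s; rewrite E !expr2 !reimE /=; ring.
  apply: (is_derive_eq (is_derive_quadratic _ _ _ _)).
  have -> : e * (a + b * (e * rC t + k) *+ 2) = c1 + c2 * rC t * 2.
    by rewrite /c1 /c2; ring.
  by rewrite (_ : 2 = 1 + 1 :> C)// !reimE /=; ring.
- have -> : (fun s => im (a * (e * rC s + k) + b * (e * rC s + k) ^+ 2)) =
    (fun s => im c0 + im c1 * s + im c2 * s ^+ 2).
    by apply/funext => s; rewrite E !expr2 !reimE /=; ring.
  apply: (is_derive_eq (is_derive_quadratic _ _ _ _)).
  have -> : e * (a + b * (e * rC t + k) *+ 2) = c1 + c2 * rC t * 2.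
    by rewrite /c1 /c2; ring.
  by rewrite (_ : 2 = 1 + 1 :> C)// !reimE /=; ring.
Qed.

(** The integral of a function over the boundary of the rectangle with lower left
    corner (x, y) and sides s, t, in terms of primitives H and V of the function
    along horizontal and vertical lines. In this form additivity under cutting
    is an identity of terms. *)
Definition boundary (H V : R -> R -> C) (x y s t : R) : C :=
  (H (x + s) y - H x y) + (V (x + s) (y + t) - V (x + s) y)
  - (H (x + s) (y + t) - H x (y + t)) - (V x (y + t) - V x y).

Section LinePrimitives.
Variables (G : C -> C) (H V : R -> R -> C).
Hypothesis HP : forall y, cprim (fun x => H x y) (fun x => G (mkC x y)).
Hypothesis VP : forall x, cprim (fun y => V x y) (fun y => 'i * G (mkC x y)).

(** Subtracting from G its affine approximation at z0 changes nothing, and leaves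
    an integrand of size o(s + t) on a contour of length 2 (s + t). *)
Lemma boundary_small z0 l e : 0 < e -> cdiff G z0 l ->
  exists2 d, 0 < d & forall x y s t, s < d -> t < d ->
    x <= re z0 <= x + s -> y <= im z0 <= y + t ->
    cabs (boundary H V x y s t) <= e * (s + t) ^+ 2.
Proof.
move=> e0 hl; have e4 : 0 < e / 4 by rewrite divr_gt0.
have [d d0 hd] := hl _ e4; exists (d / 2); first by rewrite divr_gt0.
move=> x y s t sd td /andP[x1 x2] /andP[y1 y2].
have s0 : 0 <= s by lra.
have t0 : 0 <= t by lra.
pose b := l / 2.
pose A z := G z0 * (z - z0) + b * (z - z0) ^+ 2.
pose H' u v := H u v - A (mkC u v); pose V' u v := V u v - A (mkC u v).
have -> : boundary H V x y s t = boundary H' V' x y s t.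
  by rewrite /boundary /H' /V'; ring.
have dA z : G z0 + b * (z - z0) *+ 2 = G z0 + l * (z - z0).
  by rewrite -mulrnAl /b -mulr_natr divfK// pnatr_eq0.
have H'P v : cprim (fun u => H' u v)
    (fun u => G (mkC u v) - (G z0 + l * (mkC u v - z0))).
  have E u : 1 * rC u + (mkC 0 v - z0) = mkC u v - z0.
    by apply: C_ext; rewrite !reimE /=; ring.
  have := cprimB (HP v) (cprim_affine (G z0) b 1 (mkC 0 v - z0)).
  by congr (cprim _ _); apply/funext => u; rewrite E// mul1r dA.
have V'P u : cprim (fun v => V' u v)
    (fun v => 'i * (G (mkC u v) - (G z0 + l * (mkC u v - z0)))).
  have E v : 'i * rC v + (mkC u 0 - z0) = mkC u v - z0.
    by apply: C_ext; rewrite !reimE /=; ring.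
  have := cprimB (VP u) (cprim_affine (G z0) b 'i (mkC u 0 - z0)).
  by congr (cprim _ _); apply/funext => v; rewrite E// dA -mulrBr.
have Gsmall u v : x <= u <= x + s -> y <= v <= y + t ->
    cabs (G (mkC u v) - (G z0 + l * (mkC u v - z0))) <= e / 4 * (s + t).
  move=> /andP[u1 u2] /andP[v1 v2].
  have h : cabs (mkC u v - z0) <= s + t.
    apply: (le_trans (cabs_le_reim _)); rewrite !reimE lerD//.
      by rewrite ler_norml; apply/andP; split; lra.
    by rewrite ler_norml; apply/andP; split; lra.
  rewrite opprD addrA; apply: (le_trans (hd _ _)); first by apply: (le_lt_trans h); lra.
  by rewrite ler_pM2l.
have Hb v : y <= v <= y + t ->
    cabs (H' (x + s) v - H' x v) <= (e / 4 * (s + t) * s) *+ 2.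
  move=> hv; have -> : e / 4 * (s + t) * s = e / 4 * (s + t) * ((x + s) - x) by ring.
  apply: (cprim_bound (H'P v)); first by rewrite lerDl.
  by move=> u hu; apply: Gsmall.
have Vb u : x <= u <= x + s ->
    cabs (V' u (y + t) - V' u y) <= (e / 4 * (s + t) * t) *+ 2.
  move=> hv; have -> : e / 4 * (s + t) * t = e / 4 * (s + t) * ((y + t) - y) by ring.
  apply: (cprim_bound (V'P u)); first by rewrite lerDl.
  by move=> v hu; rewrite cabsM cabs_i mul1r; apply: Gsmall.
have xl : x <= x <= x + s by rewrite lexx lerDl.
have xr : x <= x + s <= x + s by rewrite lexx lerDl s0.
have yl : y <= y <= y + t by rewrite lexx lerDl.
have yr : y <= y + t <= y + t by rewrite lexx lerDl t0.
have := Hb _ yl; have := Hb _ yr; have := Vb _ xl; have := Vb _ xr.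
rewrite /boundary => b1 b2 b3 b4.
apply: (le_trans (cabsB _ _)); apply: (le_trans (lerD (cabsB _ _) (lexx _))).
apply: (le_trans (lerD (lerD (cabsD _ _) (lexx _)) (lexx _))).
apply: (le_trans (lerD (lerD (lerD b4 b1) b3) b2)).
by rewrite le_eqVlt; apply/predU1P; left; field.
Qed.

(** The bound e (s + t)^2 is inherited from the four quarters of a rectangle and
    holds near each point, hence holds for every e > 0 by bisection. *)
Lemma goursat x y s t : 0 <= s -> 0 <= t ->
  (forall z, x <= re z <= x + s -> y <= im z <= y + t -> exists l, cdiff G z l) ->
  boundary H V x y s t = 0.
Proof.
move=> s0 t0 dG; apply/eqP; rewrite -cabs_eq0 eq_le cabs_ge0 andbT.
apply/ler_addgt0Pr => e e0; rewrite add0r.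
have st0 : 0 < (s + t + 1) ^+ 2 by rewrite exprn_gt0// -[ltLHS]add0r ler_ltD// addr_ge0.
have e'0 : 0 < e / (s + t + 1) ^+ 2 by rewrite divr_gt0.
apply: (@le_trans _ _ (e / (s + t + 1) ^+ 2 * (s + t) ^+ 2)); last first.
  rewrite -mulrA -[leRHS]mulr1 ler_pM2l// mulrC ler_pdivrMr// mul1r.
  by rewrite ler_pXn2r// ?nnegrE ?addr_ge0// lerDl.
move: (e / (s + t + 1) ^+ 2) e'0 => e' e'0.
apply: (rectangle_bisection (P := fun x y s t =>
  cabs (boundary H V x y s t) <= e' * (s + t) ^+ 2)) => //.
- move=> u v p q b1 b2 b3 b4.
  have -> : boundary H V u v (p *+ 2) (q *+ 2) =
    boundary H V u v p q + boundary H V (u + p) v p q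
    + boundary H V u (v + q) p q + boundary H V (u + p) (v + q) p q.
    by rewrite /boundary !mulr2n !(addrA u) !(addrA v); ring.
  apply: (le_trans (cabsD _ _)); apply: (le_trans (lerD (cabsD _ _) (lexx _))).
  apply: (le_trans (lerD (lerD (cabsD _ _) (lexx _)) (lexx _))).
  apply: (le_trans (lerD (lerD (lerD b1 b2) b3) b4)).
  by rewrite le_eqVlt; apply/predU1P; left; ring.
- move=> a b ha hb; have [l hl] := dG (mkC a b) ha hb.
  exact: boundary_small e'0 hl.
Qed.

End LinePrimitives.
End Goursat.

(** * A weak maximum principle *)

Section MaximumModulus.
Variable R : realType.
Local Notation C := (Cplx R).

Lemma cdiff_of_derivable F (z : C) : derivable F z 1 -> cdiff F z ('D_1 F z).
Proof.
move=> dF e e0.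
have e0C : 0 < rC e by rewrite -rC0 rC_lt.
have /cvgrPdist_le /(_ _ e0C) := dF.
case/nbhs_ballP => d /= d0 hd.
exists (re d) => [|w].
  by move: d0; rewrite ltcE => /andP[].
have dE : d = rC (re d).
  by apply: C_ext => //; move: d0; rewrite ltcE => /andP[/eqP].
have [->|wz] := eqVneq w z; first by rewrite !subrr mulr0 subr0 cabs0 mulr0.
move=> hw.
have /hd : ball (0 : C) d (w - z : C) by rewrite /ball /= sub0r normrN dE norm_cabs rC_lt.
move/(_ (_ : w - z != 0)); rewrite subr_eq0 => /(_ wz).
rewrite /= [_ *: 1]mulr1 subrK norm_cabs rC_le => h.
have wz0 : 0 < cabs (w - z) by rewrite cabs_gt0 subr_eq0.
rewrite -cabsN opprB.
have -> : 'D_1 F z * (w - z) - (F w - F z) =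
  ('D_1 F z - (w - z)^-1 *: (F w - F z)) * (w - z).
  by rewrite mulrBl [_ *: _]mulrC divfK// subr_eq0.
by rewrite cabsM ler_pM2r.
Qed.

Section PuncturedSquare.
Variables (G : C -> C) (H V : R -> R -> C).
Hypothesis HP : forall y, cprim (fun x => H x y) (fun x => G (mkC x y)).
Hypothesis VP : forall x, cprim (fun y => V x y) (fun y => 'i * G (mkC x y)).

Lemma boundary_le x y s t m : 0 <= s -> 0 <= t ->
  (forall z, x <= re z <= x + s -> y <= im z <= y + t -> cabs (G z) <= m) ->
  cabs (boundary H V x y s t) <= m * (s + t) *+ 4.
Proof.
move=> s0 t0 Gm.
have Hb v : y <= v <= y + t -> cabs (H (x + s) v - H x v) <= (m * s) *+ 2.
  move=> hv; have -> : m * s = m * ((x + s) - x) by ring.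
  apply: (cprim_bound (HP v)); first by rewrite lerDl.
  by move=> u hu; apply: Gm.
have Vb u : x <= u <= x + s -> cabs (V u (y + t) - V u y) <= (m * t) *+ 2.
  move=> hu; have -> : m * t = m * ((y + t) - y) by ring.
  apply: (cprim_bound (VP u)); first by rewrite lerDl.
  by move=> v hv; rewrite cabsM cabs_i mul1r; apply: Gm.
have xl : x <= x <= x + s by rewrite lexx lerDl.
have xr : x <= x + s <= x + s by rewrite lexx lerDl s0.
have yl : y <= y <= y + t by rewrite lexx lerDl.
have yr : y <= y + t <= y + t by rewrite lexx lerDl t0.
have := Hb _ yl; have := Hb _ yr; have := Vb _ xl; have := Vb _ xr.
rewrite /boundary => b1 b2 b3 b4.
apply: (le_trans (cabsB _ _)); apply: (le_trans (lerD (cabsB _ _) (lexx _))).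
apply: (le_trans (lerD (lerD (cabsD _ _) (lexx _)) (lexx _))).
apply: (le_trans (lerD (lerD (lerD b4 b1) b3) b2)).
by rewrite le_eqVlt; apply/predU1P; left; ring.
Qed.

(** The square is cut into four rectangles avoiding 0 and a small square around
    0, whose contribution tends to 0 with its size since G is bounded there. *)
Lemma goursat_punctured a : 0 < a -> ccont G 0 ->
  (forall z, z != 0 -> exists l, cdiff G z l) ->
  boundary H V (- a) (- a) (a *+ 2) (a *+ 2) = 0.
Proof.
move=> a0 cG dG.
have dre z : re z != 0 -> exists l, cdiff G z l.
  by move=> h; apply: dG; apply: contraNneq h => ->; rewrite reimE.
have dim z : im z != 0 -> exists l, cdiff G z l.
  by move=> h; apply: dG; apply: contraNneq h => ->; rewrite reimE.
(* Two full-height strips on the sides, then the strips below and above. *)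
have shrink b : 0 < b -> b < a -> boundary H V (- a) (- a) (a *+ 2) (a *+ 2) =
    boundary H V (- b) (- b) (b *+ 2) (b *+ 2).
  move=> b0 ba.
  have g1 : boundary H V (- a) (- a) (a - b) (a *+ 2) = 0.
    apply: (goursat HP VP); rewrite ?mulrn_wge0 ?subr_ge0 ?ltW// => z /andP[_ h] _.
    by apply: dre; rewrite lt_eqF//; lra.
  have g2 : boundary H V b (- a) (a - b) (a *+ 2) = 0.
    apply: (goursat HP VP); rewrite ?mulrn_wge0 ?subr_ge0 ?ltW// => z /andP[h _] _.
    by apply: dre; rewrite gt_eqF//; lra.
  have g3 : boundary H V (- b) (- a) (b *+ 2) (a - b) = 0.
    apply: (goursat HP VP); rewrite ?mulrn_wge0 ?subr_ge0 ?ltW// => z _ /andP[_ h].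
    by apply: dim; rewrite lt_eqF//; lra.
  have g4 : boundary H V (- b) b (b *+ 2) (a - b) = 0.
    apply: (goursat HP VP); rewrite ?mulrn_wge0 ?subr_ge0 ?ltW// => z _ /andP[h _].
    by apply: dim; rewrite gt_eqF//; lra.
  move: g1 g2 g3 g4; rewrite /boundary.
  have -> : - a + (a - b) = - b by ring.
  have -> : - a + a *+ 2 = a by ring.
  have -> : b + (a - b) = a by ring.
  have -> : - b + b *+ 2 = b by ring.
  move=> g1 g2 g3 g4; apply/eqP; rewrite -subr_eq0; apply/eqP.
  rewrite -[RHS](addr0 0) -{1}g1 -g2 -[RHS]addr0 -g3 -[RHS]addr0 -g4; ring.
apply/eqP; rewrite -cabs_eq0 eq_le cabs_ge0 andbT.
apply/ler_addgt0Pr => e e0; rewrite add0r.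
have [d d0 hd] := cG 1 ltr01.
pose m := cabs (G 0) + 1.
have m0 : 0 < m by rewrite ltr_wpDl ?cabs_ge0.
pose b := Num.min (Num.min (a / 2) (d / 4)) (e / (16 * m)).
have b0 : 0 < b by rewrite !lt_min !divr_gt0// mulr_gt0.
have ba : b <= a / 2 by rewrite !ge_min lexx.
have bd : b <= d / 4 by rewrite !ge_min lexx orbT.
have be : b <= e / (16 * m) by rewrite !ge_min lexx orbT.
rewrite (shrink b)//; last by lra.
apply: (le_trans (boundary_le (m := m) _ _ _)); rewrite ?mulrn_wge0 ?(ltW b0)//.
  move=> z /andP[h1 h2] /andP[h3 h4].
  rewrite -[G z](subrK (G 0)) addrC; apply: (le_trans (cabsD _ _)).
  rewrite lerD2l ltW//; apply: hd; rewrite subr0.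
  have r1 : `|re z| <= b by rewrite ler_norml; apply/andP; split; lra.
  have r2 : `|im z| <= b by rewrite ler_norml; apply/andP; split; lra.
  by apply: (le_lt_trans (cabs_le_reim _)); lra.
have -> : m * (b *+ 2 + b *+ 2) *+ 4 = b * (16 * m) by ring.
by rewrite -ler_pdivlMr// mulr_gt0.
Qed.

End PuncturedSquare.

Lemma cdiff_near F G (z l : C) d : 0 < d ->
  (forall w, cabs (w - z) < d -> F w = G w) -> cdiff F z l -> cdiff G z l.
Proof.
move=> d0 FG dF e e0; have [d' d'0 hd] := dF e e0.
exists (Num.min d d'); first by rewrite lt_min d0.
move=> w; rewrite lt_min => /andP[wd wd'].
by rewrite -!FG ?subrr ?cabs0//; apply: hd.
Qed.

Lemma quotient_derivable (F : C -> C) (z : C) p : p != z ->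
  derivable F z 1 -> derivable (fun w => (F w - F p) / (w - p)) z 1.
Proof.
move=> pz dF.
have dN := derivableB dF (derivable_cst (F p) z (1 : C)).
have dp := derivableB (derivable_id (x := z) (v := (1 : C))) (derivable_cst p z (1 : C)).
have zp0 : (id - cst p : C -> C) z != 0 by rewrite !fctE subr_eq0 eq_sym.
exact: (derivableM dN (derivableV zp0 dp)).
Qed.

(** The bottom side of a square centred at 0 is t - i a, with - a <= t <= a, and
    the other three are its images under multiplication by i, - 1 and - i. *)
Lemma side_sign (g k : C) (t a : R) : 0 < a -> `|t| <= a ->
  g * mkC t (- a) = k - 1 -> cabs k < 2^-1 -> im g < 0.
Proof.
move=> a0 ta e kl.
have k1 := le_lt_trans (re_le_cabs k) kl; have k2 := le_lt_trans (im_le_cabs k) kl.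
have := congr1 (@re R) e; have := congr1 (@im R) e; rewrite !reimE => e2 e1.
have : im g * (t ^+ 2 + a ^+ 2) = a * (re k - 1) + t * im k.
  by rewrite -e1; rewrite subr0 in e2; rewrite -e2; ring.
have ta2 : 0 < t ^+ 2 + a ^+ 2 by rewrite ltr_wpDl ?sqr_ge0 ?exprn_gt0.
move=> E; rewrite -(pmulr_llt0 _ ta2) E.
have h1 : t * im k <= a * 2^-1.
  apply: (le_trans (ler_norm _)); rewrite normrM ler_pM//.
  exact: ltW.
have h2 : a * re k < a * 2^-1 by rewrite ltr_pM2l//; apply: le_lt_trans (ler_norm _) k1.
by rewrite mulrBr; lra.
Qed.

(** A maximum principle up to a factor 2, from the vanishing of the integral of
    (F - F(0)) / z along a square. After normalising F(0) = 1, if F were smaller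
    than 1 / 2 on the square, the integrand would be close enough to - 1 / z for
    its integral to have negative imaginary part along each of the four sides. *)
Lemma center_le_twice_annulus (F : C -> C) (a M : R) : 0 < a ->
  (forall z, derivable F z 1) ->
  (forall z, a <= cabs z <= a *+ 2 -> cabs (F z) <= M) ->
  cabs (F 0) <= M *+ 2.
Proof.
move=> a0 dF FM; rewrite leNgt; apply/negP => F0M.
have M0 : 0 <= M.
  apply: (le_trans (cabs_ge0 (F (rC a)))); apply: FM.
  by rewrite cabs_rC gtr0_norm// lexx mulr2n lerDl ltW.
have F00 : F 0 != 0 by rewrite -cabs_gt0; apply: le_lt_trans F0M; rewrite mulrn_wge0.
pose K := (fun z => F z / F 0) : C -> C.
have K0 : K 0 = 1 by rewrite /K divff.
have dK z : derivable K z 1.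
  exact: (derivableM (dF z) (derivable_cst (F 0)^-1 z (1 : C))).
have Ks z : a <= cabs z <= a *+ 2 -> cabs (K z) < 2^-1.
  move=> /FM h; rewrite /K cabsM cabsV ltr_pdivrMr ?cabs_gt0//.
  by rewrite mulrC ltr_pdivlMr//; apply: le_lt_trans F0M; rewrite mulr_natr ler_wMn2r.
pose l0 := 'D_1 K 0.
pose G := (fun z => if z == 0 then l0 else (K z - K 0) / (z - 0)) : C -> C.
have GE z : G z * z = K z - 1.
  rewrite /G; case: eqVneq => [->|z0]; first by rewrite mulr0 K0 subrr.
  by rewrite subr0 K0 divfK.
have cG0 : ccont G 0.
  move=> e e0; have e20 : 0 < e / 2 by rewrite divr_gt0.
  have [d d0 hd] := cdiff_of_derivable (dK 0) e20.
  exists d => // w /hd; rewrite /G eqxx; case: eqVneq => [->|w0].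
    by move=> _; rewrite subrr cabs0.
  rewrite subr0 => h.
  have w0' : 0 < cabs w by rewrite cabs_gt0.
  apply: (@le_lt_trans _ _ (e / 2)); last by lra.
  rewrite -(ler_pM2r w0') -cabsM mulrBl divfK//.
have dG z : z != 0 -> exists l, cdiff G z l.
  move=> z0; have z0' : 0 != z by rewrite eq_sym.
  have /cdiff_of_derivable h := quotient_derivable z0' (dK z).
  move: ('D_1 _ z) h => l h; exists l.
  apply: (cdiff_near (d := cabs z) _ _ h); first by rewrite cabs_gt0.
  move=> w; rewrite /G; case: eqVneq => // ->.
  by rewrite sub0r cabsN ltxx.
have cG z : ccont G z.
  have [->//|/dG[l dl]] := eqVneq z 0.
  exact: ccont_of_cdiff dl.
have [H HP] : exists H : R -> R -> C,
    forall y, cprim (fun x => H x y) (fun x => G (mkC x y)).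
  have /choice[h hP] : forall y, exists phi, cprim phi (fun x => G (mkC x y)).
    move=> y; apply: cprim_exists => t e e0; have [d d0 hd] := cG (mkC t y) e e0.
    exists d => // s sd; apply: hd.
    have -> : mkC s y - mkC t y = rC (s - t) by apply: C_ext; rewrite !reimE// subrr.
    by rewrite cabs_rC.
  by exists (fun x y => h y x).
have [V VP] : exists V : R -> R -> C,
    forall x, cprim (fun y => V x y) (fun y => 'i * G (mkC x y)).
  have /choice[v vP] : forall x, exists phi, cprim phi (fun y => 'i * G (mkC x y)).
    move=> x; apply: cprim_exists => t e e0.
    have [d d0 hd] := cG (mkC x t) e e0.
    exists d => // s sd; rewrite -mulrBr cabsM cabs_i mul1r; apply: hd.
    have -> : mkC x s - mkC x t = 'i * rC (s - t) by apply: C_ext; rewrite !reimE /=; ring.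
    by rewrite cabsM cabs_i mul1r cabs_rC.
  by exists v.
have := goursat_punctured HP VP a0 cG0 dG.
rewrite /boundary (_ : - a + a *+ 2 = a); last by ring.
move/(congr1 (@im R)); rewrite !reimE.
have aa : - a < a by lra.
have ann t u : -a <= t <= a -> `|u| = a -> a <= cabs (mkC t u) <= a *+ 2 /\
    a <= cabs (mkC u t) <= a *+ 2.
  move=> ht hu; have ht' : `|t| <= a by rewrite ler_norml.
  split; apply/andP; split.
  - by rewrite -{1}hu (le_trans _ (im_le_cabs _)).
  - by rewrite (le_trans (cabs_le_reim _))//= hu mulr2n lerD.
  - by rewrite -{1}hu (le_trans _ (re_le_cabs _)).
  - by rewrite (le_trans (cabs_le_reim _))//= hu mulr2n lerD.
have na : `|a| = a by rewrite gtr0_norm.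
have nNa : `|- a| = a by rewrite normrN.
have [c1 hc1 e1] := MVT_everywhere aa (fun t => (HP (- a) t).2).
have [c2 hc2 e2] := MVT_everywhere aa (fun t => (VP a t).2).
have [c3 hc3 e3] := MVT_everywhere aa (fun t => (HP a t).2).
have [c4 hc4 e4] := MVT_everywhere aa (fun t => (VP (- a) t).2).
have t1 : `|c1| <= a by rewrite ler_norml.
have t2 : `|c2| <= a by rewrite ler_norml.
have t3 : `|- c3| <= a by rewrite normrN ler_norml.
have t4 : `|- c4| <= a by rewrite normrN ler_norml.
have s1 : im (G (mkC c1 (- a))) < 0.
  by apply: (side_sign a0 t1 (GE _)); apply/Ks/(ann _ _ hc1 nNa).1.
have s2 : im ('i * G (mkC a c2)) < 0.
  apply: (side_sign a0 t2 (k := K (mkC a c2))); last by apply/Ks/(ann _ _ hc2 na).2.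
  by rewrite -GE [_ * G _]mulrC -mulrA; congr (_ * _); apply: C_ext; rewrite !reimE /=; ring.
have s3 : im (- G (mkC c3 a)) < 0.
  apply: (side_sign a0 t3 (k := K (mkC c3 a))); last by apply/Ks/(ann _ _ hc3 na).1.
  by rewrite -GE mulNr -mulrN; congr (_ * _); apply: C_ext; rewrite !reimE /=; ring.
have s4 : im (- ('i * G (mkC (- a) c4))) < 0.
  apply: (side_sign a0 t4 (k := K (mkC (- a) c4))); last by apply/Ks/(ann _ _ hc4 nNa).2.
  rewrite -GE [_ * G _]mulrC -mulNr mulrAC mulNr -mulrN -mulrA.
  by congr (_ * _); apply: C_ext; rewrite !reimE /=; ring.
rewrite e1 e2 e3 e4; rewrite imN in s3; rewrite imN in s4.
have a2 : 0 < a - - a by lra.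
rewrite -mulrDl -!mulrBl => /eqP; rewrite mulf_eq0 (gt_eqF a2) orbF => /eqP.
lra.
Qed.

End MaximumModulus.

(** * Entire functions of subexponential growth *)

Section SubexponentialFunctions.
Variable R : realType.
Local Notation C := (Cplx R).
Implicit Types (F G : C -> C) (z w : C).

(** Exponential type zero. Order less than 1 implies it, and it is stable under
    sums and products with no exponent to keep track of. *)
Definition subexp F := forall eta : R, 0 < eta ->
  exists2 A, 0 <= A & forall z, cabs (F z) <= A * expR (eta * cabs z).

Definition entire_subexp F := entire F /\ subexp F.

Lemma growth_le_subexp F rho : 0 < rho < 1 -> growth_le F rho -> subexp F.
Proof.
move=> /andP[rho0 rho1] [A [B [A0 B0 hF]]] eta eta0.
have u0 : 0 < 1 - rho by rewrite subr_gt0.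
(* T is the point where B T^rho = eta T. *)
pose T := (B / eta) `^ (1 - rho)^-1.
have T0 : 0 < T by rewrite powR_gt0// divr_gt0.
exists (A * expR (B * T `^ rho)); first by rewrite mulr_ge0 ?expR_ge0// ltW.
move=> z; apply: (le_trans (hF z)).
rewrite -mulrA ler_pM2l// -expRD ler_expR.
have [zT|Tz] := leP (cabs z) T.
  apply: (@le_trans _ _ (B * T `^ rho)).
    rewrite ler_pM2l//.
    by apply: (ge0_ler_powR (ltW rho0)); rewrite ?nnegrE ?cabs_ge0// ltW.
  by rewrite lerDl mulr_ge0 ?cabs_ge0// ltW.
have z0 : 0 < cabs z := lt_trans T0 Tz.
apply: (@le_trans _ _ (eta * cabs z)); last first.
  by rewrite lerDr mulr_ge0 ?powR_ge0// ltW.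
have zE : cabs z = cabs z `^ (1 - rho) * cabs z `^ rho.
  by rewrite -powRD subrK ?powRr1 ?(ltW z0)// oner_eq0.
rewrite [in leRHS]zE mulrA ler_wpM2r ?powR_ge0// -ler_pdivrMl// mulrC.
have BE : B / eta = T `^ (1 - rho).
  by rewrite /T -powRrM mulVf ?gt_eqF// powRr1// divr_ge0 ?ltW.
rewrite BE.
by apply: (ge0_ler_powR (ltW u0)); rewrite ?nnegrE ?ltW.
Qed.

Lemma entire_subexp_of_lt1 F : entire_lt1 F -> entire_subexp F.
Proof.
case=> dF /ereal_inf_lt[_ [rho [rho0 gF] <-]]; rewrite lte_fin => rho1.
by split=> //; apply: growth_le_subexp gF; rewrite rho0.
Qed.

Lemma entire_subexp_cst c : entire_subexp (fun=> c).
Proof.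
split=> [z|eta eta0]; first exact: derivable_cst.
exists (cabs c) => [|z]; first exact: cabs_ge0.
by rewrite ler_peMr ?cabs_ge0// -expR0 ler_expR mulr_ge0 ?cabs_ge0// ltW.
Qed.

Lemma entire_subexpD F G : entire_subexp F -> entire_subexp G ->
  entire_subexp (fun z => F z + G z).
Proof.
move=> [dF sF] [dG sG]; split=> [z|eta eta0]; first exact: derivableD.
have [A A0 hA] := sF _ eta0; have [B B0 hB] := sG _ eta0.
exists (A + B) => [|z]; first exact: addr_ge0.
by rewrite mulrDl (le_trans (cabsD _ _))// lerD.
Qed.

Lemma entire_subexpM F G : entire_subexp F -> entire_subexp G ->
  entire_subexp (fun z => F z * G z).
Proof.
move=> [dF sF] [dG sG]; split=> [z|eta eta0]; first exact: derivableM.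
have eta20 : 0 < eta / 2 by rewrite divr_gt0.
have [A A0 hA] := sF _ eta20; have [B B0 hB] := sG _ eta20.
exists (A * B) => [|z]; first exact: mulr_ge0.
rewrite cabsM {1}(splitr eta) mulrDl expRD mulrACA.
by rewrite ler_pM ?cabs_ge0.
Qed.

Lemma entire_subexp_prod (I : Type) (s : seq I) (Q : pred I) (F : I -> C -> C) :
  (forall i, entire_subexp (F i)) -> entire_subexp (fun z => \prod_(i <- s | Q i) F i z).
Proof.
move=> hF; elim: s => [|i s IH].
  by under eq_fun do rewrite big_nil; exact: entire_subexp_cst.
under eq_fun do rewrite big_cons.
by case: (Q i) => //; apply: entire_subexpM.
Qed.

Lemma derivable_affine F z0 w z : derivable F (z0 + w * z) 1 ->
  derivable (fun z => F (z0 + w * z)) z 1.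
Proof.
move=> dF.
have d1 : derivable (cst z0 + cst w * id : C -> C) z 1.
  exact: (derivableD (derivable_cst z0 z (1 : C))
    (derivableM (derivable_cst w z (1 : C)) (derivable_id (x := z) (v := (1 : C))))).
have d2 : derivable F ((cst z0 + cst w * id : C -> C) z) 1 by exact: dF.
apply/derivable1_diffP.
move/derivable1_diffP: d2; move/derivable1_diffP: d1; exact: differentiable_comp.
Qed.

Lemma entire_subexp_affine F z0 w : entire_subexp F ->
  entire_subexp (fun z => F (z0 + w * z)).
Proof.
move=> [dF sF]; split=> [z|eta eta0]; first exact: derivable_affine.
pose k := 1 + cabs w; have k0 : 0 < k by rewrite ltr_pwDl// cabs_ge0.
have ek0 : 0 < eta / k by rewrite divr_gt0.
have [A A0 hA] := sF _ ek0.
exists (A * expR (eta / k * cabs z0)) => [|z]; first by rewrite mulr_ge0 ?expR_ge0.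
apply: (le_trans (hA _)); rewrite -[leRHS]mulrA -expRD ler_wpM2l// ler_expR.
apply: (@le_trans _ _ (eta / k * (cabs z0 + cabs w * cabs z))).
  by rewrite ler_pM2l// (le_trans (cabsD _ _))// cabsM.
rewrite mulrDr lerD2l mulrA ler_wpM2r ?cabs_ge0//.
rewrite -mulrA -[leRHS]mulr1 ler_pM2l// mulrC ler_pdivrMr// mul1r /k lerDr.
exact: ler01.
Qed.

End SubexponentialFunctions.

(** * Zeros are isolated *)

Section IsolatedZeros.
Variable R : realType.
Local Notation C := (Cplx R).
Implicit Types (F G : C -> C) (z w : C).

Lemma dnbhs_cabsP (P : C -> Prop) z0 :
  (\forall z \near z0^', P z) <->
  (exists2 d, 0 < d & forall z, z != z0 -> cabs (z - z0) < d -> P z).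
Proof.
split.
- case/nbhs_ballP => d /= d0 hd; exists (re d).
    by move: d0; rewrite ltcE => /andP[].
  have dE : d = rC (re d).
    by apply: C_ext => //; move: d0; rewrite ltcE => /andP[/eqP].
  move=> z zz0 zd; apply: (hd z) => //.
  by rewrite /ball /= dE distrC norm_cabs rC_lt.
- case=> d d0 hd; apply/nbhs_ballP; exists (rC d) => /=.
    by rewrite -rC0 rC_lt.
  move=> z; rewrite /ball /= distrC norm_cabs rC_lt => zd zz0; exact: hd.
Qed.

(** At a zero of F the square cancels a simple zero of the denominator; the
    value x / 0 = 0 is the right one there. *)
Lemma derivable_sqr_div F G z : derivable F z 1 -> F z = 0 ->
  derivable G z 1 -> G z != 0 ->
  derivable (fun w => F w ^+ 2 / ((w - z) * G w)) z 1.
Proof.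
move=> dF Fz dG Gz.
have cG : {for z, continuous G} by apply/differentiable_continuous/derivable1_diffP.
have cs : (fun h : C => (G (h + z))^-1) @ 0^' --> (G z)^-1.
  apply: cvgV; first exact: Gz.
  have hz : {for (0 : C), continuous (id + cst z : C -> C)}.
    apply/differentiable_continuous/derivable1_diffP.
    exact: (derivableD (derivable_id (x := (0 : C)) (v := (1 : C)))
      (derivable_cst z (0 : C) (1 : C))).
  rewrite /prop_for /continuous_at !fctE add0r in hz.
  apply: (cvg_within_filter (f := fun h : C => G (h + z))).
  exact: (cvg_comp _ _ hz cG).
have := cvgM (cvgM dF dF) cs.
move=> /(_ (dnbhs_filter _) (dnbhs_filter _)) lim_prod.
apply: cvgP; apply: cvg_trans lim_prod; apply: (@near_eq_cvg _ _ _ (dnbhs_filter _)).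
apply/dnbhs_cabsP; exists 1 => // h h0 _.
rewrite /= Fz expr0n mul0r !subr0 /= [h *: 1]mulr1 addrK.
rewrite /GRing.scale /=.
have [G0|G0] := eqVneq (G (h + z)) 0.
  by rewrite G0 mulr0 invr0 !mulr0.
by field; rewrite h0 G0.
Qed.

Lemma entire_subexp_id : entire_subexp (fun z : C => z).
Proof.
split=> [z|eta eta0]; first exact: derivable_id.
exists eta^-1 => [|z]; first by rewrite invr_ge0 ltW.
rewrite -ler_pdivrMl ?invr_gt0// invrK.
by rewrite (le_trans _ (expR_ge1Dx _))// lerDr.
Qed.

Definition nodes (s : seq C) z : C := \prod_(a <- s) (z - a).

Lemma nodes_derivable s z : derivable (nodes s) z 1.
Proof.
have [|dn _] := @entire_subexp_prod R _ s xpredT (fun a z => z - a); last exact: dn.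
move=> a; exact: (entire_subexpD entire_subexp_id (entire_subexp_cst (- a))).
Qed.

(** The quotient F^2 / prod (z - a) over zeros a of F is entire, hence bounded at
    the centre by its values far away. For |z| >= 3 d each factor z - a of the
    denominator has modulus at least 2 d, against at most d at the centre, which
    gains a factor 2 per zero. *)
Lemma center_sqr_le_nodes F (s : seq C) (d M : R) : 0 < d -> entire F ->
  uniq s -> (forall a, a \in s -> F a = 0 /\ cabs a <= d) ->
  (forall z, d *+ 3 <= cabs z <= d *+ 6 -> cabs (F z) <= M) ->
  cabs (F 0) ^+ 2 <= M ^+ 2 *+ 2 * 2^-1 ^+ size s.
Proof.
move=> d0 dF us sF FM.
pose K := (fun z => F z ^+ 2 / nodes s z) : C -> C.
have dK z : derivable K z 1.
  have [zs|zs] := boolP (z \in s).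
    have Fz0 := (sF z zs).1.
    have -> : K = fun w => F w ^+ 2 / ((w - z) * nodes (rem z s) w).
      apply/funext => w; rewrite /K /nodes; congr (_ / _).
      by rewrite (perm_big _ (perm_to_rem zs)) big_cons.
    apply: derivable_sqr_div => //; first exact: nodes_derivable.
    rewrite /nodes prodf_seq_neq0; apply/allP => a.
    by rewrite (mem_rem_uniq z us) inE subr_eq0 eq_sym => /andP[-> _].
  have nz : nodes s z != 0.
    rewrite /nodes prodf_seq_neq0; apply/allP => a hs.
    by rewrite /= subr_eq0; apply: contraNneq zs => ->.
  have dn := derivableV nz (@nodes_derivable s z).
  have dFF := derivableM (dF z) (dF z).
  exact: (derivableM dFF dn).
have [Fz0|F0] := eqVneq (F 0) 0.
  by rewrite Fz0 cabs0 expr0n mulr_ge0 ?mulrn_wge0 ?sqr_ge0 ?exprn_ge0 ?invr_ge0.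
have s0 a : a \in s -> a != 0.
  by move=> /sF[Fa _]; apply: contraNneq F0 => a0; rewrite -{1}a0 Fa.
have nodes_ge z : d *+ 3 <= cabs z -> (d *+ 2) ^+ size s <= cabs (nodes s z).
  move=> hz; rewrite /nodes cabs_prod.
  have : all (fun a => cabs a <= d) s by apply/allP => a /sF[].
  elim: (s) => [|a t IH] /=; first by rewrite big_nil expr0.
  move=> /andP[ha /IH h]; rewrite big_cons exprS ler_pM ?exprn_ge0 ?mulrn_wge0 ?(ltW d0)//.
  by apply: le_trans (cabs_subl _ _); lra.
have nodes_le : cabs (nodes s 0) <= d ^+ size s.
  rewrite /nodes cabs_prod.
  have : all (fun a => cabs a <= d) s by apply/allP => a /sF[].
  elim: (s) => [|a t IH] /=; first by rewrite big_nil expr0.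
  move=> /andP[ha /IH h]; rewrite big_cons exprS ler_pM ?cabs_ge0 ?sub0r ?cabsN//.
  by apply: prodr_ge0 => i _; exact: cabs_ge0.
have nodes0 : 0 < cabs (nodes s 0).
  rewrite cabs_gt0 /nodes prodf_seq_neq0; apply/allP => a /s0.
  by rewrite /= sub0r oppr_eq0.
have d2n : 0 < (d *+ 2) ^+ size s by rewrite exprn_gt0// mulrn_wgt0.
have d3 : 0 < d *+ 3 by rewrite mulrn_wgt0.
have Kb z : d *+ 3 <= cabs z <= d *+ 3 *+ 2 -> cabs (K z) <= M ^+ 2 / (d *+ 2) ^+ size s.
  rewrite -mulrnA => hz; have [hz1 hz2] := andP hz.
  rewrite /K cabsM cabsV cabsX ler_pM ?invr_ge0 ?cabs_ge0 ?exprn_ge0 ?cabs_ge0//.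
    by rewrite lerXn2r ?nnegrE ?cabs_ge0// ?FM// (le_trans _ (FM z hz)) ?cabs_ge0.
  rewrite lef_pV2 ?posrE ?nodes_ge//.
  by apply: (lt_le_trans d2n); exact: nodes_ge.
have := center_le_twice_annulus d3 dK Kb.
rewrite /K cabsM cabsV cabsX ler_pdivrMr// => h; apply: (le_trans h).
have -> : M ^+ 2 *+ 2 * 2^-1 ^+ size s =
    (M ^+ 2 / (d *+ 2) ^+ size s) *+ 2 * d ^+ size s.
  rewrite -(mulr_natr d 2) exprMn exprVn; field.
  by rewrite !expf_neq0 ?gt_eqF.
by rewrite ler_wpM2l// mulrn_wge0// divr_ge0 ?sqr_ge0 ?ltW.
Qed.

(** With the values on the annulus bounded independently of the number n of zeros,
    the estimate of the centre tends to 0 like 2^-n. *)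
Lemma entire_subexp_many_zeros F z0 (d : R) : entire_subexp F -> 0 < d ->
  (forall n, exists s : seq C, [/\ uniq s, size s = n &
     forall a, a \in s -> F a = 0 /\ cabs (a - z0) <= d]) ->
  F z0 = 0.
Proof.
move=> [dF sF] d0 hs.
have [A A0 hA] := sF 1 ltr01.
pose M := A * expR (cabs z0 + d *+ 6).
suff h n : cabs (F z0) ^+ 2 <= M ^+ 2 *+ 2 * 2^-1 ^+ n.
  apply/eqP; rewrite -cabs_eq0 -sqrf_eq0 eq_le sqr_ge0 andbT leNgt; apply/negP => h0.
  set x := cabs _ ^+ 2 in h h0; set y := M ^+ 2 *+ 2 in h.
  have := archi_boundP (_ : 0 <= y / x); rewrite divr_ge0 ?(ltW h0) ?mulrn_wge0 ?sqr_ge0//.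
  move=> /(_ isT); set n := Num.bound _; rewrite ltNge => /negP; apply.
  apply: (@le_trans _ _ (2 ^+ n)).
    by rewrite -natrX ler_nat ltnW// ltn_expl.
  rewrite ler_pdivlMr// mulrC -ler_pdivlMr ?exprn_gt0//.
  by have := h n; rewrite exprVn.
have [s [us <- sz]] := hs n.
pose t := [seq a - z0 | a <- s].
have -> : size s = size t by rewrite size_map.
have := @center_sqr_le_nodes (fun z => F (z0 + 1 * z)) t d M d0.
rewrite mulr0 addr0; apply.
- by move=> z; apply: derivable_affine; exact: dF.
- by rewrite map_inj_uniq//; exact: addIr.
- move=> _ /mapP[a /sz[Fa ha] ->]; split => //.
  by rewrite mul1r addrC subrK.
move=> z /andP[_ hz]; apply: (le_trans (hA _)).
rewrite ler_wpM2l// ler_expR !mul1r (le_trans (cabsD _ _))// lerD2l//.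
Qed.

(** If the zeros accumulate at z0, there are arbitrarily many of them within a
    fixed distance of any point w, so F vanishes at w. *)
Lemma entire_subexp_isolated_zeros F : entire_subexp F -> (exists z, F z != 0) ->
  forall z0, \forall z \near z0^', F z != 0.
Proof.
move=> eF [w Fw] z0; apply/dnbhs_cabsP; apply: contrapT => hn.
have small (d : R) : 0 < d -> exists z, [/\ z != z0, cabs (z - z0) < d & F z = 0].
  move=> d0; apply: contrapT => hz; apply: hn; exists d => // z zz0 zd.
  by apply/eqP => Fz; apply: hz; exists z.
have many n (d : R) : 0 < d -> exists s : seq C, [/\ uniq s, size s = n &
     forall a, a \in s -> [/\ F a = 0, a != z0 & cabs (a - z0) < d]].
  elim: n d => [|n IH] d d0; first by exists [::].
  have [a [az0 ad Fa]] := small d d0.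
  have ha : 0 < cabs (a - z0) by rewrite cabs_gt0 subr_eq0.
  have [s [us sn sF]] := IH _ ha; exists (a :: s); split => /=.
  - by rewrite us andbT; apply/negP => /sF[_ _]; rewrite ltxx.
  - by rewrite sn.
  - move=> b; rewrite inE => /predU1P[->//|/sF[Fb bz0 bd]]; split => //.
    exact: lt_trans ad.
move/eqP: Fw; apply; pose d := cabs (z0 - w) + 1.
have d0 : 0 < d by rewrite ltr_wpDl ?cabs_ge0.
apply: (@entire_subexp_many_zeros F w d) => // n.
have [s [us sn sF]] := many n 1 ltr01; exists s; split => // a /sF[Fa _ ad].
split=> //; rewrite -(subrK z0 a) -addrA (le_trans (cabsD _ _))//.
by rewrite /d [leRHS]addrC lerD2r ltW.
Qed.

Lemma entire_subexp_integral F G : entire_subexp F -> entire_subexp G ->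
  (exists z, F z != 0) -> (exists z, G z != 0) -> exists z, F z * G z != 0.
Proof.
move=> eF eG nF nG.
have /dnbhs_cabsP[d1 d10 h1] := entire_subexp_isolated_zeros eF nF 0.
have /dnbhs_cabsP[d2 d20 h2] := entire_subexp_isolated_zeros eG nG 0.
pose d := Num.min d1 d2 / 2; have d0 : 0 < d by rewrite divr_gt0// lt_min d10.
have dd : d < Num.min d1 d2.
  by rewrite ltr_pdivrMr// ltr_pMr ?lt_min ?d10// ltr1n.
move: dd; rewrite lt_min => /andP[dd1 dd2].
exists (rC d); rewrite mulf_neq0//.
  apply: h1; last by rewrite subr0 cabs_rC gtr0_norm.
  by rewrite -cabs_gt0 cabs_rC normr_gt0 gt_eqF.
apply: h2; last by rewrite subr0 cabs_rC gtr0_norm.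
by rewrite -cabs_gt0 cabs_rC normr_gt0 gt_eqF.
Qed.

Lemma entire_subexp_prod_neq0 (I : eqType) (s : seq I) (F : I -> C -> C) :
  (forall i, entire_subexp (F i)) -> (forall i, exists z, F i z != 0) ->
  exists z, \prod_(i <- s) F i z != 0.
Proof.
move=> eF nF; elim: s => [|i s IH].
  by exists 0; rewrite big_nil oner_neq0.
have := entire_subexp_integral (eF i) (entire_subexp_prod s xpredT eF) (nF i) IH.
by move=> [z hz]; exists z; rewrite big_cons.
Qed.

End IsolatedZeros.

(** * Linear independence of exponentials *)

Section Cones.
Variable R : realType.
Local Notation C := (Cplx R).
Implicit Types (F G : C -> C) (z w u : C).

Lemma small_grid (U e : R) : 0 < e -> exists ws : seq C, forall y,
  cabs y <= U -> exists2 w, w \in ws & cabs (w - y) <= e.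
Proof.
move=> e0; have e20 : 0 < e / 2 by rewrite divr_gt0.
have [xs hxs] : exists xs : seq R, forall x, `|x| <= U ->
    exists2 x', x' \in xs & `|x' - x| <= e / 2.
  exists [seq - U + k%:R * (e / 2) | k <- iota 0 (Num.bound (U *+ 2 / (e / 2)))].
  move=> x; rewrite ler_norml => /andP[x1 x2].
  have y0 : 0 <= (x + U) / (e / 2) by rewrite divr_ge0 ?(ltW e20)//; lra.
  have /andP[k1 k2] := truncn_itv y0.
  set k := Num.truncn _ in k1 k2.
  rewrite ler_pdivlMr// in k1; rewrite ltr_pdivrMr// in k2.
  exists (- U + k%:R * (e / 2)).
    apply/mapP; exists k => //; rewrite mem_iota /= add0n -(ltr_nat R).
    apply: (@le_lt_trans _ _ (U *+ 2 / (e / 2))).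
      by rewrite ler_pdivlMr//; lra.
    by apply: archi_boundP; rewrite divr_ge0 ?(ltW e20)//; lra.
  rewrite -natr1 mulrDl mul1r in k2.
  by rewrite ler_norml; apply/andP; split; lra.
exists [seq mkC x y | x <- xs, y <- xs] => y hy.
have [x1 x1s h1] := hxs _ (le_trans (re_le_cabs y) hy).
have [x2 x2s h2] := hxs _ (le_trans (im_le_cabs y) hy).
exists (mkC x1 x2); first exact: allpairs_f.
apply: (le_trans (cabs_le_reim _)); rewrite !reimE; lra.
Qed.

Lemma prod_le_one_small (I : eqType) (s : seq I) (x : I -> R) (i : I) (m E : R) :
  i \in s -> 1 <= E -> (forall j, j \in s -> 0 <= x j <= E) -> x i <= m ->
  \prod_(j <- s) x j <= m * E ^+ size s.
Proof.
move=> si E1 hx hm; have E0 : 0 <= E by apply: le_trans E1.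
rewrite (perm_big _ (perm_to_rem si)) big_cons (perm_size (perm_to_rem si)) /=.
have hr : all (fun j => 0 <= x j <= E) (rem i s).
  by apply/allP => j /mem_rem; exact: hx.
have [p0 p1] : 0 <= \prod_(j <- rem i s) x j /\
    \prod_(j <- rem i s) x j <= E ^+ size (rem i s).
  elim: (rem i s) hr => [|j t IH] /=; first by rewrite big_nil expr0 ler01.
  move=> /andP[/andP[x0 x1] /IH[q0 q1]]; rewrite big_cons exprS mulr_ge0//.
  by split => //; apply: ler_pM.
have xi0 : 0 <= x i by case/andP: (hx i si).
apply: ler_pM => //; apply: (le_trans p1).
by rewrite ler_weXn2l.
Qed.

Lemma expR_decay_le0 (x K k a0 : R) : 0 < k -> 0 <= K ->
  (forall a, a0 <= a -> x <= K * expR (- (k * a))) -> x <= 0.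
Proof.
move=> k0 K0 h; rewrite leNgt; apply/negP => x0.
pose a := Num.max a0 (K / (x * k)).
have a0a : a0 <= a by rewrite le_max lexx.
have Ka : K <= a * (x * k).
  by rewrite -ler_pdivrMr ?mulr_gt0// le_max lexx orbT.
have := h a a0a; rewrite leNgt => /negP; apply.
rewrite expRN ltr_pdivrMr ?expR_gt0//.
apply: (@lt_le_trans _ _ (x * (1 + k * a))).
  have -> : x * (1 + k * a) = x + a * (x * k) by ring.
  by rewrite ltr_pwDl.
by rewrite ler_pM2l// expR_ge1Dx.
Qed.

(** The union over t > 0 of these discs is the cone around the ray through u. *)
Definition in_cone u (e t : R) z := cabs (z - rC t * u) <= e * t.

(** The linear parts w run through a grid so fine that for each z far away some
    w z lies in the cone. In the product of the functions F (z0 + w z) one factor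
    is then tiny, so the product is 0 at the centre z = 0. *)
Lemma cone_decay_eq0 F u (e T A k : R) : entire_subexp F -> 0 < e -> 0 < k ->
  (forall t z, T <= t -> in_cone u e t z -> cabs (F z) <= A * expR (- (k * t))) ->
  forall z0, F z0 = 0.
Proof.
move=> [dF sF] e0 k0 hF z0.
have e20 : 0 < e / 2 by rewrite divr_gt0.
have [ws hws] := small_grid (cabs u) e20.
pose W := \sum_(w <- ws) cabs w.
have W0 : 0 <= W by apply: sumr_ge0 => w _; apply: cabs_ge0.
have wW w : w \in ws -> cabs w <= W.
  move=> hw; rewrite /W (perm_big _ (perm_to_rem hw)) big_cons lerDl.
  by apply: sumr_ge0 => v _; apply: cabs_ge0.
pose N := size ws.
have N0 : (0 < N)%N.
  have [w + _] := hws u (lexx _); rewrite /N; by case: ws {hws W W0 wW N}.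
(* eta is chosen so that the N factors F (z0 + w z), for |z| <= 2 a, grow at most
   like exp (k a / 2) together, half the decay rate of the tiny factor. *)
pose D := (N%:R * (W + 1) * 4 : R).
have D0 : 0 < D by rewrite !mulr_gt0 ?ltr0n// ltr_wpDl.
pose eta := k / D; have eta0 : 0 < eta by rewrite divr_gt0.
have [B0 B00 hB0] := sF _ eta0.
pose B := B0 + 1; have B1 : 1 <= B by rewrite lerDr.
have Bge0 : 0 <= B by apply: le_trans B1.
have A0 : 0 <= A.
  have Tb : T <= T by [].
  have : 0 <= A * expR (- (k * Num.max T 0)).
    apply: (le_trans (cabs_ge0 (F (rC (Num.max T 0) * u)))); apply: hF.
      by rewrite le_max lexx.
    by rewrite /in_cone subrr cabs0 mulr_ge0 ?(ltW e0)// le_max lexx orbT.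
  by rewrite pmulr_lge0 ?expR_gt0.
pose K := A * (B * expR (eta * cabs z0)) ^+ N *+ 2.
have K0 : 0 <= K by rewrite mulrn_wge0// mulr_ge0 ?exprn_ge0 ?mulr_ge0 ?expR_ge0.
suff : cabs (F z0) ^+ N <= 0.
  move=> h; apply/eqP; rewrite -cabs_eq0.
  have : cabs (F z0) ^+ N == 0 by rewrite eq_le h exprn_ge0// cabs_ge0.
  by rewrite expf_eq0 N0.
pose a0 := Num.max 1 (Num.max T (cabs z0 / (e / 2))).
apply: (@expR_decay_le0 _ K (k / 2) a0); rewrite ?divr_gt0// => a.
rewrite !ge_max => /and3P[a1 aT az0].
have apos : 0 < a by apply: lt_le_trans a1.
pose G z := \prod_(w <- ws) F (z0 + w * z).
have eG : entire_subexp G by apply: entire_subexp_prod => w; apply: entire_subexp_affine.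
have G0 : cabs (G 0) = cabs (F z0) ^+ N.
  rewrite cabs_prod; under eq_bigr do rewrite mulr0 addr0.
  by rewrite big_const_seq count_predT iter_mulr_1.
rewrite -G0.
pose E := B * expR (eta * cabs z0) * expR (eta * (W * (a *+ 2))).
have E1 : 1 <= E.
  rewrite /E -mulrA -expRD -[leLHS]mulr1 ler_pM// -expR0 ler_expR.
  by rewrite addr_ge0// mulr_ge0 ?(ltW eta0) ?cabs_ge0// mulr_ge0// mulrn_wge0// ltW.
have Gb z : a <= cabs z <= a *+ 2 -> cabs (G z) <= A * expR (- (k * a)) * E ^+ N.
  move=> /andP[za1 za2]; set t := cabs z in za1 za2.
  have t0 : 0 < t by apply: lt_le_trans za1.
  have z0' : z != 0 by rewrite -cabs_gt0.
  pose v := z / rC t.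
  have rt0 : rC t != 0 by rewrite -cabs_gt0 cabs_rC normr_gt0 gt_eqF.
  have v1 : cabs v = 1 by rewrite cabsM cabsV cabs_rC gtr0_norm// divff// gt_eqF.
  have v0 : v != 0 by rewrite -cabs_gt0 v1.
  have [w ws_w wv] : exists2 w, w \in ws & cabs (w - u / v) <= e / 2.
    by apply: hws; rewrite cabsM cabsV v1 invr1 mulr1.
  have zin : in_cone u e t (z0 + w * z).
    rewrite /in_cone.
    have -> : z0 + w * z - rC t * u = z0 + (w - u / v) * z.
      by rewrite /v; field; rewrite z0' rt0.
    apply: (le_trans (cabsD _ _)).
    have -> : e * t = t * (e / 2) + e / 2 * t by field.
    rewrite lerD//; last by rewrite cabsM ler_wpM2r// ltW.
    by rewrite -ler_pdivrMr//; apply: le_trans za1.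
  rewrite cabs_prod; apply: (prod_le_one_small ws_w E1) => [w' hw'|].
    rewrite cabs_ge0; apply: (le_trans (hB0 _)).
    rewrite /E -mulrA -expRD; apply: ler_pM => //; rewrite ?expR_ge0 ?lerDl//.
    rewrite ler_expR -mulrDr ler_pM2l// (le_trans (cabsD _ _))// lerD2l cabsM.
    by apply: ler_pM; rewrite ?cabs_ge0// wW.
  have tT : T <= t by apply: le_trans za1.
  apply: (le_trans (hF _ _ tT zin)).
  by rewrite ler_wpM2l// ler_expR lerN2 ler_pM2l.
have [dG _] := eG.
apply: (le_trans (center_le_twice_annulus apos dG Gb)).
rewrite /K /E -/N exprMn -expRM_natl; set Z := _ ^+ N.
set y := expR (N%:R * _); set y1 := expR (- (k * a)).
have -> : (A * y1 * (Z * y)) *+ 2 = A * Z *+ 2 * (y1 * y) by ring.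
rewrite ler_wpM2l// /y /y1 -expRD ler_expR.
have etaD : eta * (N%:R * (W + 1) * 4) = k by rewrite /eta divfK// gt_eqF.
have h : N%:R * (eta * (W * (a *+ 2))) <= N%:R * (eta * ((W + 1) * (a *+ 2))).
  by rewrite ler_wpM2l// ler_pM2l// ler_wpM2r ?mulrn_wge0 ?(ltW apos)// lerDl.
apply: (le_trans (lerD (lexx _) h)).
by rewrite -etaD le_eqVlt; apply/predU1P; left; field.
Qed.

Definition cone_growing u (Q : {poly C}) := exists e k T : R,
  [/\ 0 < e, 0 < k & forall t z, T <= t -> in_cone u e t z -> k * t <= re Q.[z]].

Lemma cone_growingD u Q1 Q2 :
  cone_growing u Q1 -> cone_growing u Q2 -> cone_growing u (Q1 + Q2).
Proof.
move=> [e1 [k1 [T1 [e10 k10 h1]]]] [e2 [k2 [T2 [e20 k20 h2]]]].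
exists (Num.min e1 e2), (k1 + k2), (Num.max 0 (Num.max T1 T2)).
split; [by rewrite lt_min e10 | by rewrite addr_gt0 |] => t z.
rewrite !ge_max => /and3P[t0 t1 t2] hz.
rewrite hornerD reD mulrDl lerD//.
  by apply: h1 => //; apply: (le_trans hz); rewrite ler_wpM2r// ge_min lexx.
by apply: h2 => //; apply: (le_trans hz); rewrite ler_wpM2r// ge_min lexx orbT.
Qed.

Lemma cone_growing_uniform u (I : eqType) (s : seq I) (Q : I -> {poly C}) :
  (forall i, i \in s -> cone_growing u (Q i)) ->
  exists e k T : R, [/\ 0 < e, 0 < k & forall i, i \in s ->
    forall t z, T <= t -> in_cone u e t z -> k * t <= re (Q i).[z]].
Proof.
elim: s => [|i s IH] hs; first by exists 1, 1, 0.
have [|e1 [k1 [T1 [e10 k10 h1]]]] := IH.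
  by move=> j js; apply: hs; rewrite inE js orbT.
have [|e2 [k2 [T2 [e20 k20 h2]]]] := hs i; first by rewrite mem_head.
exists (Num.min e1 e2), (Num.min k1 k2), (Num.max 0 (Num.max T1 T2)).
split; [by rewrite lt_min e10 | by rewrite lt_min k10 |] => j js t z.
rewrite !ge_max => /and3P[t0 t1 t2] hz.
have z1 : in_cone u e1 t z by apply: (le_trans hz); rewrite ler_wpM2r// ge_min lexx.
have z2 : in_cone u e2 t z by apply: (le_trans hz); rewrite ler_wpM2r// ge_min lexx orbT.
move: js; rewrite inE => /predU1P[->|js].
  by apply: le_trans (h2 _ _ t2 z2); rewrite ler_wpM2r// ge_min lexx orbT.
by apply: le_trans (h1 _ js _ _ t1 z1); rewrite ler_wpM2r// ge_min lexx.
Qed.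

Lemma monomial_ccont (c : C) n z : ccont (fun v => c * v ^+ n) z.
Proof.
have [] : entire_subexp (fun v : C => c * v ^+ n).
  apply: entire_subexpM; first exact: entire_subexp_cst.
  elim: n => [|n IH]; first exact: entire_subexp_cst.
  by under eq_fun do rewrite exprS; apply: entire_subexpM IH; exact: entire_subexp_id.
by move=> d _; apply: (ccont_of_cdiff (cdiff_of_derivable (d z))).
Qed.

(** Writing z = t v with v near u, the leading term is t^n Re (c v^n) and the
    others are O(t^(n - 1)). *)
Lemma cone_growing_of_leading u (Q : {poly C}) : (1 < size Q)%N ->
  0 < re (lead_coef Q * u ^+ (size Q).-1) -> cone_growing u Q.
Proof.
set n := (size Q).-1 => Q1; set s := re _ => s0.
have [m nE] : exists m, n = m.+1.
  by exists n.-1; rewrite /n prednK//; case: (size Q) Q1 => [|[]].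
have QE : size Q = n.+1 by rewrite /n prednK// ltnW.
have s20 : 0 < s / 2 by rewrite divr_gt0.
have [d d0 hd] := monomial_ccont (lead_coef Q) n u s20.
pose e := Num.min 1 (d / 2).
have e0 : 0 < e by rewrite lt_min ltr01 divr_gt0.
pose W := cabs u + 1; have W0 : 0 <= W by rewrite addr_ge0 ?cabs_ge0.
pose L := \sum_(i < n) cabs Q`_i * W ^+ i.
have L0 : 0 <= L by apply: sumr_ge0 => i _; rewrite mulr_ge0 ?cabs_ge0 ?exprn_ge0.
exists e, (s / 4), (Num.max 1 (4 * L / s)); split; rewrite ?divr_gt0// => t z.
rewrite ge_max => /andP[t1 tL] hz.
have t0 : 0 < t by apply: lt_le_trans t1.
have rt0 : rC t != 0 by rewrite -cabs_gt0 cabs_rC normr_gt0 gt_eqF.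
pose v := z / rC t; have zE : z = rC t * v by rewrite /v mulrC divfK.
have vu : cabs (v - u) <= e.
  move: hz; rewrite /in_cone zE -mulrBr cabsM cabs_rC gtr0_norm// mulrC.
  by rewrite ler_pM2r.
have vW : cabs v <= W.
  rewrite -[v](subrK u) (le_trans (cabsD _ _))// addrC lerD2l (le_trans vu)//.
  by rewrite ge_min lexx.
have lead : s / 2 <= re (lead_coef Q * v ^+ n).
  have := hd v; move/(_ _)/(le_lt_trans (re_le_cabs _)).
  have vd : cabs (v - u) < d.
    apply: (le_lt_trans vu); rewrite gt_min; apply/orP; right.
    by rewrite ltr_pdivrMr// ltr_pMr// ltr1n.
  by move/(_ vd); rewrite reB -/s ltr_norml => /andP[h _]; lra.
rewrite horner_coef QE big_ord_recr /= reD -[Q`_n]/(lead_coef Q).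
set low := \sum_(i < n) _.
have hlow : cabs low <= t ^+ m * L.
  apply: (le_trans (cabs_sum _ _ _)); rewrite mulr_sumr; apply: ler_sum => i _.
  rewrite cabsM cabsX zE cabsM cabs_rC gtr0_norm// exprMn mulrCA.
  apply: ler_pM; rewrite ?mulr_ge0 ?cabs_ge0 ?exprn_ge0 ?(ltW t0) ?cabs_ge0//.
    by apply: ler_weXn2l => //; rewrite -ltnS -nE.
  by rewrite ler_wpM2l ?cabs_ge0// lerXn2r ?nnegrE ?cabs_ge0.
have lead' : re (lead_coef Q * z ^+ n) = t ^+ n * re (lead_coef Q * v ^+ n).
  rewrite zE exprMn mulrCA.
  have -> : rC t ^+ n = rC (t ^+ n).
    by elim: (n) => [|k IH]; rewrite ?expr0// !exprS rCM IH.
  by rewrite reM re_mk im_mk mul0r subr0.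
have lowre : - (t ^+ m * L) <= re low.
  by move: (le_trans (re_le_cabs low) hlow); rewrite ler_norml => /andP[].
rewrite lead'.
have tm1 : 1 <= t ^+ m by rewrite exprn_ege1.
have tL4 : 4 * L <= t * s by rewrite -ler_pdivrMr.
have : t ^+ n * (s / 2) <= t ^+ n * re (lead_coef Q * v ^+ n).
  by rewrite ler_pM2l// exprn_gt0.
rewrite nE exprS -/m.
have : 0 <= (t ^+ m - 1) * (t * (s / 4)).
  by rewrite mulr_ge0 ?subr_ge0// mulr_ge0 ?ltW// divr_gt0.
have : 0 <= t ^+ m * (t * s - 4 * L) by rewrite mulr_ge0 ?subr_ge0// (le_trans ler01).
move=> h1 h2 h3.
have e1 : t ^+ m * (t * s - 4 * L) = t ^+ m * t * s - 4 * (t ^+ m * L) by ring.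
have e2 : (t ^+ m - 1) * (t * (s / 4)) = t ^+ m * t * s / 4 - s / 4 * t by field.
have e3 : t * t ^+ m * (s / 2) = t ^+ m * t * s / 2 by field.
rewrite e1 in h1; rewrite e2 in h2; rewrite e3 in h3.
lra.
Qed.

Definition cconj z : C := mkC (re z) (- im z).

Lemma conjM z w : cconj (z * w) = cconj z * cconj w.
Proof. by apply: C_ext; rewrite !reimE; ring. Qed.
Lemma conjX z n : cconj (z ^+ n) = cconj z ^+ n.
Proof.
elim: n => [|n IH]; last by rewrite !exprS conjM IH.
by apply: C_ext; rewrite !expr0 !reimE ?oppr0.
Qed.
Lemma addr_conj_eq0 z : re z = 0 -> z + cconj z = 0.
Proof. by move=> h; apply: C_ext; rewrite !reimE ?h ?addr0 ?subrr. Qed.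

(** Only finitely many u on the line 1 + i R fail: Re (c u^n) is there a
    polynomial in the ordinate, whose value at the ordinate - i is c 2^n. *)
Lemma generic_direction (s : seq (C * nat)) :
  (forall x, x \in s -> x.1 != 0 /\ (0 < x.2)%N) ->
  exists u, forall x, x \in s -> re (x.1 * u ^+ x.2) != 0.
Proof.
move=> hs.
pose q (x : C * nat) : {poly C} :=
  x.1 *: (1 + 'i *: 'X) ^+ x.2 + (cconj x.1) *: (1 - 'i *: 'X) ^+ x.2.
have qE x y : (q x).[y] = x.1 * (1 + 'i * y) ^+ x.2 + cconj x.1 * (1 - 'i * y) ^+ x.2.
  by rewrite /q !(hornerD, hornerZ, horner_exp, hornerN, hornerX, hornerC).
have ii : ('i : C) * 'i = -1 by apply: C_ext; rewrite !reimE /=; ring.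
have q0 x : x \in s -> q x != 0.
  move=> /hs[x0 xn]; apply/eqP => /(congr1 (fun p => p.[- 'i])).
  rewrite qE horner0 mulrN opprK ii opprK subrr expr0n gtn_eqF// mulr0 addr0.
  by apply/eqP; rewrite mulf_neq0// expf_neq0// (_ : 1 + 1 = 2)// pnatr_eq0.
pose Q := \prod_(x <- s) q x.
have Q0 : Q != 0 by rewrite prodf_seq_neq0; apply/allP => x /q0.
have [m Qm] : exists m : nat, ~~ root Q m%:R.
  apply: contrapT => h.
  have := @max_poly_roots _ Q [seq m%:R | m <- iota 0 (size Q)] Q0.
  rewrite size_map size_iota ltnn map_inj_uniq ?iota_uniq; last first.
    by move=> a b /eqP; rewrite eqr_nat => /eqP.
  move=> hroots; have // : false; apply: hroots => //.
  by apply/allP => _ /mapP[m _ ->]; apply: contrapT => hm; apply: h; exists m; apply/negP.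
exists (1 + 'i * m%:R) => x xs.
have : (q x).[m%:R] != 0.
  move: Qm; rewrite /root /Q horner_prod prodf_seq_neq0 => /allP /(_ x xs).
  by [].
apply: contraNneq => h; rewrite qE.
have -> : cconj x.1 * (1 - 'i * m%:R) ^+ x.2 = cconj (x.1 * (1 + 'i * m%:R) ^+ x.2).
  rewrite conjM conjX; congr (_ * _ ^+ _).
  have -> : m%:R = rC m%:R :> C.
    by elim: m {Qm h} => [|m IH]//; rewrite -!natr1 IH rCD.
  by apply: C_ext; rewrite !reimE /=; ring.
by apply/eqP; exact: addr_conj_eq0.
Qed.

(** Growing differences form a strict order by [cone_growingD], which is total for
    a generic u; a finite set has a largest element. *)
Lemma dominating_index u (I : eqType) (s : seq I) (P : I -> {poly C}) :
  s != [::] ->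
  (forall j k, j \in s -> k \in s -> j != k ->
    cone_growing u (P j - P k) \/ cone_growing u (P k - P j)) ->
  exists2 k, k \in s & forall j, j \in s -> j != k -> cone_growing u (P k - P j).
Proof.
elim: s => [//|i [|i' s] IH] _ hs.
  exists i; first exact: mem_head.
  by move=> j; rewrite inE => /eqP ->; rewrite eqxx.
have [||k ks hk] := IH; rewrite //.
  by move=> j k hj hk; apply: hs; rewrite inE ?hj ?hk orbT.
have [ik|ik] := eqVneq i k.
  exists k; first by rewrite inE ks orbT.
  by move=> j; rewrite inE ik => /predU1P[->|]; [rewrite eqxx | exact: hk].
have ks' : k \in [:: i, i' & s] by rewrite in_cons ks orbT.
have [h|h] := hs i k (mem_head _ _) ks' ik.
  exists i; first by rewrite mem_head.
  move=> j; rewrite in_cons => /predU1P[->|js]; first by rewrite eqxx.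
  have [->//|jk] := eqVneq j k.
  move=> _; have -> : P i - P j = (P i - P k) + (P k - P j) by rewrite addrA subrK.
  by apply: cone_growingD => //; apply: hk.
exists k => // j; rewrite in_cons => /predU1P[->//|]; exact: hk.
Qed.

Lemma cabs_cexp z : cabs (cexp z) = expR (re z).
Proof.
rewrite /cexp /re; case: z => x y /=.
have -> : cabs ((expR x)%:C * (cos y +i* sin y) : R[i]) =
  cabs (rC (expR x) * mkC (cos y) (sin y)) by [].
rewrite cabsM cabs_rC ger0_norm ?expR_ge0// cabsE /= cos2Dsin2 sqrtr1 mulr1.
by [].
Qed.

(** Along a generic ray one exponential e^(P k), among those with b k <> 0,
    dominates all others by an exponential factor in a cone. Solving the relation
    for b k shows that b k decays exponentially in that cone, so b k = 0. *)
Theorem exponentials_independent (I : finType) (P : I -> {poly C})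
    (b : I -> C -> C) :
  (forall j k, j != k -> (1 < size (P j - P k)%R)%N) ->
  (forall k, entire_subexp (b k)) ->
  (forall z, \sum_k b k z * cexp (P k).[z] = 0) ->
  forall k z, b k z = 0.
Proof.
move=> Pne eb sum0.
pose s := [seq k <- enum I | `[< exists z, b k z != 0 >]].
suff s_nil : s = [::].
  move=> k z; apply/eqP/negPn/negP => bkz.
  have : k \in s by rewrite mem_filter mem_enum andbT; apply/asboolP; exists z.
  by rewrite s_nil.
apply: contrapT => /eqP s0.
pose deg j k := (lead_coef (P j - P k), (size (P j - P k)%R).-1).
have [u hu] : exists u, forall j k, j != k ->
    re (lead_coef (P j - P k) * u ^+ (size (P j - P k)%R).-1) != 0.
  pose dirs := [seq deg x.1 x.2 | x <- enum {: I * I} & x.1 != x.2].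
  have [|u hu] := @generic_direction dirs.
    move=> x /mapP[[j k]]; rewrite mem_filter /= => /andP[/Pne jk _] -> /=.
    rewrite lead_coef_eq0 -size_poly_gt0 (ltn_trans _ jk)//; split => //.
    by case: (size _) jk => [|[]].
  exists u => j k jk; apply: (hu (deg j k)); apply/mapP; exists (j, k) => //.
  by rewrite mem_filter /= jk mem_enum.
have [||k ks hk] := @dominating_index u I s P; rewrite //.
  move=> j k _ _ jk; have := hu j k jk; rewrite neq_lt => /orP[h|h]; last first.
    by left; apply: cone_growing_of_leading => //; exact: Pne.
  right; apply: cone_growing_of_leading; first by apply: Pne; rewrite eq_sym.
  by rewrite -(opprB (P j)) lead_coefN size_polyN mulNr reN oppr_gt0.
pose Q j := P k - P j; pose s' := rem k s.
have us : uniq s by rewrite filter_uniq// enum_uniq.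
have [|e [kap [T [e0 kap0 hgrow]]]] := @cone_growing_uniform u I s' Q.
  by move=> j; rewrite mem_rem_uniq// inE => /andP[jk js]; apply: hk.
pose W := cabs u + e; have W0 : 0 < W by rewrite ltr_wpDl ?cabs_ge0.
pose eta := kap / 2 / W; have eta0 : 0 < eta by rewrite !divr_gt0.
have /choice[A hA] : forall j, exists A, 0 <= A /\
    forall z, cabs (b j z) <= A * expR (eta * cabs z).
  by move=> j; have [A A0 h] := (eb j).2 _ eta0; exists A.
have bk0 : forall z, b k z = 0.
  apply: (@cone_decay_eq0 (b k) u e (Num.max 0 T) (\sum_(j <- s') A j) (kap / 2)) => //.
    by rewrite divr_gt0.
  move=> t z; rewrite ge_max => /andP[t0 tT] hz.
  have zW : cabs z <= W * t.
    rewrite -(subrK (rC t * u) z) (le_trans (cabsD _ _))//.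
    rewrite /W mulrDl addrC cabsM cabs_rC ger0_norm// [t * _]mulrC lerD2l.
    exact: hz.
  have main : b k z * cexp (P k).[z] = - \sum_(j <- s') b j z * cexp (P j).[z].
    apply/eqP; rewrite -subr_eq0 opprK; apply/eqP.
    rewrite -[RHS](sum0 z) -(big_cons _ _ k s' xpredT (fun j => b j z * cexp (P j).[z])).
    rewrite -(perm_big _ (perm_to_rem ks)) /= /s big_filter big_enum_cond /=.
    rewrite big_mkcond /=; apply: eq_bigr => j _; case: asboolP => // h.
    apply/esym/eqP; rewrite mulf_eq0; apply/orP; left.
    by apply/negPn/negP => bj; apply: h; exists z.
  rewrite -(ler_pM2r (expR_gt0 (re (P k).[z]))) -cabs_cexp -cabsM main cabsN.
  apply: (le_trans (cabs_sum _ _ _)).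
  rewrite cabs_cexp -[leRHS]mulrA mulr_suml big_seq_cond [leRHS]big_seq_cond.
  apply: ler_sum => j; rewrite andbT => js'.
  have [Aj0 hj] := hA j.
  rewrite cabsM cabs_cexp.
  apply: (le_trans (ler_wpM2r (expR_ge0 _) (hj z))).
  rewrite -[leLHS]mulrA ler_wpM2l// -!expRD ler_expR.
  have := hgrow j js' t z tT hz; rewrite /Q hornerD hornerN reB.
  have : eta * cabs z <= kap / 2 * t.
    apply: (@le_trans _ _ (eta * (W * t))); first by rewrite ler_pM2l.
    by rewrite mulrA /eta divfK// gt_eqF.
  lra.
move: ks; rewrite mem_filter => /andP[/asboolP[z]].
by rewrite bk0 eqxx.
Qed.

End Cones.

(** * Meromorphic quotients *)

Section MeromorphicQuotients.
Variable R : realType.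
Local Notation C := (Cplx R).
Implicit Types (F G : C -> C) (z w : C).

Lemma cexpD z w : cexp (z + w) = cexp z * cexp w.
Proof.
case: z => a b; case: w => c d; rewrite /cexp /=.
have -> : (expR (a + c))%:C = (expR a)%:C * (expR c)%:C :> R[i] by rewrite expRD rmorphM.
rewrite mulrACA; congr (_ * _); apply: C_ext; rewrite /re /im /=.
  by rewrite cosD.
by rewrite sinD addrC.
Qed.

Lemma cexp0 : cexp (0 : C) = 1.
Proof.
apply: C_ext; rewrite /cexp /re /im /= expR0 cos0 sin0; ring.
Qed.

Lemma cexp_sum (I : Type) (s : seq I) (Q : I -> C) :
  cexp (\sum_(i <- s) Q i) = \prod_(i <- s) cexp (Q i).
Proof. by elim/big_rec2: _ => [|i x y _ <-]; rewrite ?cexp0// cexpD. Qed.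

Lemma cexpMn z n : cexp (z *+ n) = cexp z ^+ n.
Proof. by elim: n => [|n IH]; rewrite ?cexp0// mulrS exprS cexpD IH. Qed.

Lemma real_cont (f : R -> R) : continuous f -> forall x e, 0 < e ->
  exists2 d, 0 < d & forall y, `|y - x| < d -> `|f y - f x| < e.
Proof.
move=> cf x e e0; have /cvgrPdist_lt /(_ e e0) /nbhs_ballP[d /= d0 hd] := cf x.
exists d => // y yd; rewrite distrC; apply: (hd y).
by rewrite /ball /= distrC.
Qed.

Lemma ccontD F G z : ccont F z -> ccont G z -> ccont (fun w => F w + G w) z.
Proof.
move=> cF cG e e0; have e20 : 0 < e / 2 by rewrite divr_gt0.
have [d1 d10 h1] := cF _ e20; have [d2 d20 h2] := cG _ e20.
exists (Num.min d1 d2); first by rewrite lt_min d10.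
move=> w; rewrite lt_min => /andP[/h1 a1 /h2 a2].
rewrite opprD addrACA; apply: (le_lt_trans (cabsD _ _)); lra.
Qed.

Lemma ccontM F G z : ccont F z -> ccont G z -> ccont (fun w => F w * G w) z.
Proof.
move=> cF cG e e0.
pose k := 1 + cabs (F z) + cabs (G z).
have k0 : 0 < k by rewrite /k -addrA ltr_pwDl// addr_ge0 ?cabs_ge0.
pose e' := Num.min 1 (e / k); have e'0 : 0 < e' by rewrite lt_min ltr01 divr_gt0.
have [d1 d10 h1] := cF _ e'0; have [d2 d20 h2] := cG _ e'0.
exists (Num.min d1 d2); first by rewrite lt_min d10.
move=> w; rewrite lt_min => /andP[/h1 a1 /h2 a2].
have -> : F w * G w - F z * G z =
  (F w - F z) * (G w - G z) + (F z * (G w - G z) + (F w - F z) * G z) by ring.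
apply: (@lt_le_trans _ _ (e' * k)); last by rewrite -ler_pdivlMr// ge_min lexx orbT.
apply: (le_lt_trans (cabsD _ _)).
apply: (le_lt_trans (lerD (lexx _) (cabsD _ _))).
rewrite !cabsM /k -addrA mulrDr mulr1 ltr_leD//.
  apply: (@le_lt_trans _ _ (cabs (F w - F z) * 1)); last by rewrite mulr1.
  rewrite ler_wpM2l ?cabs_ge0// (le_trans (ltW a2))// ge_min lexx//.
rewrite mulrDr lerD//; first by rewrite mulrC ler_wpM2r ?cabs_ge0// ltW.
by rewrite ler_wpM2r ?cabs_ge0// ltW.
Qed.

Lemma cexp_ccont z : ccont (@cexp R) z.
Proof.
move=> e e0; pose k := expR (re z); have k0 : 0 < k by exact: expR_gt0.
pose e' := Num.min 1 (e / (k * 4)).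
have e'0 : 0 < e' by rewrite lt_min ltr01 divr_gt0// mulr_gt0.
have [d1 d10 h1] := real_cont (@continuous_expR R) 0 e'0.
have [d2 d20 h2] := real_cont (@continuous_cos R) 0 e'0.
have [d3 d30 h3] := real_cont (@continuous_sin R) 0 e'0.
exists (Num.min d1 (Num.min d2 d3)); first by rewrite !lt_min d10 d20.
move=> w; rewrite !lt_min => /and3P[w1 w2 w3].
have -> : cexp w - cexp z = cexp z * (cexp (w - z) - 1).
  by rewrite mulrBr mulr1 -cexpD [z + _]addrC subrK.
rewrite cabsM cabs_cexp -/k.
set h := w - z in w1 w2 w3 *.
have a1 : `|expR (re h) - 1| < e'.
  by rewrite -expR0; apply: h1; rewrite subr0; apply: le_lt_trans (re_le_cabs _) w1.
have a2 : `|cos (im h) - 1| < e'.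
  by rewrite -cos0; apply: h2; rewrite subr0; apply: le_lt_trans (im_le_cabs _) w2.
have a3 : `|sin (im h)| < e'.
  rewrite -[sin _]subr0 -[X in _ - X]sin0; apply: h3; rewrite subr0.
  by apply: le_lt_trans (im_le_cabs _) w3.
have -> : cexp h - 1 = mkC (expR (re h) * cos (im h) - 1) (expR (re h) * sin (im h)).
  by case: h {w1 w2 w3 a1 a2 a3} => x y; apply: C_ext; rewrite /cexp /re /im /=; ring.
have e'1 : e' <= 1 by rewrite ge_min lexx.
have E2 : expR (re h) <= 2.
  by have := le_lt_trans (ler_norm _) a1; lra.
have E0 : 0 <= expR (re h) by exact: expR_ge0.
have b1 : `|expR (re h) * cos (im h) - 1| < e' + e'.
  have -> : expR (re h) * cos (im h) - 1 =
    (expR (re h) - 1) * cos (im h) + (cos (im h) - 1) by ring.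
  apply: (le_lt_trans (ler_normD _ _)); rewrite ltrD//.
  apply: le_lt_trans a1; rewrite normrM -[leRHS]mulr1 ler_wpM2l//.
  by rewrite ler_norml cos_geN1 cos_le1.
have b2 : `|expR (re h) * sin (im h)| <= 2 * e'.
  by rewrite normrM ger0_norm// ler_pM// ltW.
apply: (@lt_le_trans _ _ (k * (4 * e'))).
  rewrite ltr_pM2l//; apply: (le_lt_trans (cabs_le_reim _)).
  rewrite re_mk im_mk; apply: (lt_le_trans (ltr_leD b1 b2)).
  by rewrite le_eqVlt; apply/predU1P; left; ring.
by rewrite mulrA mulrC -ler_pdivlMr ?mulr_gt0// ge_min lexx orbT.
Qed.

Lemma ccont_comp_cexp F z : ccont F z -> ccont (fun w => cexp (F w)) z.
Proof.
move=> cF e e0; have [d d0 hd] := cexp_ccont (F z) e0.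
by have [d' d'0 hd'] := cF d d0; exists d' => // w /hd' /hd.
Qed.

Lemma entire_ccont F z : entire F -> ccont F z.
Proof. by move=> dF; apply: (ccont_of_cdiff (cdiff_of_derivable (dF z))). Qed.

Lemma ccont_sum (I : Type) (s : seq I) (F : I -> C -> C) z :
  (forall i, ccont (F i) z) -> ccont (fun w => \sum_(i <- s) F i w) z.
Proof.
move=> cF; elim: s => [|i s IH].
  by under eq_fun do rewrite big_nil; move=> e e0; exists 1 => // w _; rewrite subrr cabs0.
by under eq_fun do rewrite big_cons; apply: ccontD.
Qed.

Lemma horner_ccont (P : {poly C}) z : ccont (fun w => P.[w]) z.
Proof.
under eq_fun do rewrite horner_coef.
by apply: ccont_sum => i; apply: monomial_ccont.
Qed.

Lemma ccont_eq0 F z : ccont F z -> (\forall w \near z^', F w = 0) -> F z = 0.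
Proof.
move=> cF /dnbhs_cabsP[d d0 hd]; apply/eqP; rewrite -cabs_eq0 eq_le cabs_ge0 andbT.
apply/ler_addgt0Pr => e e0; rewrite add0r.
have [d' d'0 hd'] := cF e e0.
pose m := Num.min d d' / 2; have m0 : 0 < m by rewrite divr_gt0// lt_min d0.
have : m < Num.min d d' by rewrite ltr_pdivrMr// ltr_pMr ?lt_min ?d0// ltr1n.
rewrite lt_min => /andP[md md'].
have wz : z + rC m - z = rC m by rewrite addrC addKr.
have cm : cabs (rC m) = m by rewrite cabs_rC gtr0_norm.
have := hd' (z + rC m); rewrite wz cm => /(_ md').
rewrite (hd (z + rC m)) ?wz ?cm//; first by rewrite sub0r cabsN => /ltW.
by rewrite -subr_eq0 wz -cabs_gt0 cm.
Qed.

Lemma near2 (P Q S : C -> Prop) z0 : (forall z, P z -> Q z -> S z) ->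
  (\forall z \near z0^', P z) -> (\forall z \near z0^', Q z) ->
  \forall z \near z0^', S z.
Proof.
by move=> h hP hQ; apply: (@filterS2 _ _ (dnbhs_filter z0) P Q S h hP hQ).
Qed.

Lemma near1 (P S : C -> Prop) z0 : (forall z, P z -> S z) ->
  (\forall z \near z0^', P z) -> \forall z \near z0^', S z.
Proof. by move=> h hP; apply: (near2 (fun z Pz _ => h z Pz) hP hP). Qed.

Lemma near_and (P Q : C -> Prop) z0 :
  (\forall z \near z0^', P z) -> (\forall z \near z0^', Q z) ->
  \forall z \near z0^', P z /\ Q z.
Proof. by apply: near2 => z Pz Qz; split. Qed.

Lemma near_all (I : finType) (P : I -> C -> Prop) z0 :
  (forall i, \forall z \near z0^', P i z) -> \forall z \near z0^', forall i, P i z.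
Proof. by move=> hP; apply: (filter_forall (dnbhs_filter z0) hP). Qed.

Definition mero_subexp F := exists p q,
  [/\ entire_subexp p, entire_subexp q, exists z, q z != 0 &
  mero_eq F (fun z => p z / q z)].

Lemma mero_subexp_of_lt1 F : mero_lt1 F -> mero_subexp F.
Proof.
move=> [_ [p [q [ep eq q0 Fpq]]]]; exists p, q.
by split => //; apply: entire_subexp_of_lt1.
Qed.

Lemma mero_subexp_cst c : mero_subexp (fun=> c).
Proof.
exists (fun=> c), (fun=> 1); split; [exact: entire_subexp_cst|exact: entire_subexp_cst| |].
  by exists 0; rewrite oner_eq0.
by move=> z0; apply/dnbhs_cabsP; exists 1 => // z _ _; rewrite invr1 mulr1.
Qed.

Lemma mero_subexpD F G : mero_subexp F -> mero_subexp G ->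
  mero_subexp (fun z => F z + G z).
Proof.
move=> [p [q [ep eq q0 Fpq]]] [p' [q' [ep' eq' q'0 Gpq]]].
exists (fun z => p z * q' z + p' z * q z), (fun z => q z * q' z); split.
- by apply: entire_subexpD; apply: entire_subexpM.
- exact: entire_subexpM.
- exact: entire_subexp_integral.
move=> z0.
apply: (near2 _
  (near_and (entire_subexp_isolated_zeros eq q0 z0)
    (entire_subexp_isolated_zeros eq' q'0 z0))
  (near_and (Fpq z0) (Gpq z0))).
by move=> z [h1 h2] [-> ->]; field; rewrite h1 h2.
Qed.

Lemma mero_subexpM F G : mero_subexp F -> mero_subexp G ->
  mero_subexp (fun z => F z * G z).
Proof.
move=> [p [q [ep eq q0 Fpq]]] [p' [q' [ep' eq' q'0 Gpq]]].
exists (fun z => p z * p' z), (fun z => q z * q' z); split.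
- exact: entire_subexpM.
- exact: entire_subexpM.
- exact: entire_subexp_integral.
move=> z0; apply: (near2 _ (Fpq z0) (Gpq z0)).
by move=> z -> ->; rewrite invfM mulrACA.
Qed.

Lemma mero_subexp_sum (I : Type) (s : seq I) (F : I -> C -> C) :
  (forall i, mero_subexp (F i)) -> mero_subexp (fun z => \sum_(i <- s) F i z).
Proof.
move=> mF; elim: s => [|i s IH].
  by under eq_fun do rewrite big_nil; exact: mero_subexp_cst.
by under eq_fun do rewrite big_cons; apply: mero_subexpD.
Qed.

Lemma mero_subexp_prod (I : Type) (s : seq I) (F : I -> C -> C) :
  (forall i, mero_subexp (F i)) -> mero_subexp (fun z => \prod_(i <- s) F i z).
Proof.
move=> mF; elim: s => [|i s IH].
  by under eq_fun do rewrite big_nil; exact: mero_subexp_cst.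
by under eq_fun do rewrite big_cons; apply: mero_subexpM.
Qed.

Lemma mero_subexp_isolated_zeros F : mero_subexp F -> ~ mero_eq F 0 ->
  forall z0, \forall z \near z0^', F z != 0.
Proof.
move=> [p [q [ep eq q0 Fpq]]] F0 z0.
have p0 : exists z, p z != 0.
  apply: contrapT => hp; apply: F0 => z1; apply: near1 (Fpq z1) => z ->.
  have -> : p z = 0 by apply/eqP/negPn/negP => h; apply: hp; exists z.
  by rewrite mul0r.
apply: (near2 _ (Fpq z0) (near_and (entire_subexp_isolated_zeros ep p0 z0)
  (entire_subexp_isolated_zeros eq q0 z0))).
by move=> z -> [h1 h2]; rewrite mulf_neq0// invr_neq0.
Qed.

(** Multiplying by all denominators reduces to entire coefficients; the relation
    then holds off isolated points, and everywhere by continuity. *)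
Lemma mero_subexp_exponentials_independent (I : finType) (P : I -> {poly C})
    (b : I -> C -> C) :
  (forall j k, j != k -> (1 < size (P j - P k)%R)%N) ->
  (forall k, mero_subexp (b k)) ->
  mero_eq (fun z => \sum_k b k z * cexp (P k).[z]) 0 ->
  forall k, mero_eq (b k) 0.
Proof.
move=> Pne mb sum0.
have /choice[pq hpq] : forall k, exists pq : (C -> C) * (C -> C),
    [/\ entire_subexp pq.1, entire_subexp pq.2, exists z, pq.2 z != 0 &
      mero_eq (b k) (fun z => pq.1 z / pq.2 z)].
  by move=> k; have [p [q h]] := mb k; exists (p, q).
pose p k := (pq k).1; pose q k := (pq k).2.
have ep k : entire_subexp (p k) by have [] := hpq k.
have eq k : entire_subexp (q k) by have [] := hpq k.
have q0 k : exists z, q k z != 0 by have [] := hpq k.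
have bpq k : mero_eq (b k) (fun z => p k z / q k z) by have [] := hpq k.
pose B k z := p k z * \prod_(l | l != k) q l z.
have eB k : entire_subexp (B k) by apply: entire_subexpM => //; apply: entire_subexp_prod.
have sumB z : \sum_k B k z * cexp (P k).[z] = 0.
  have cF : ccont (fun z => \sum_k B k z * cexp (P k).[z]) z.
    apply: ccont_sum => k; apply: ccontM.
      by apply: entire_ccont; case: (eB k).
    exact: ccont_comp_cexp (horner_ccont _ _).
  apply: (ccont_eq0 cF).
  have hq := near_all (fun k => entire_subexp_isolated_zeros (eq k) (q0 k) z).
  have hb := near_all (fun k => bpq k z).
  apply: (near2 _ (sum0 z) (near_and hq hb)) => w s0 [qw bw].
  have E : \prod_l q l w * (\sum_k b k w * cexp (P k).[w]) = 0.
    by rewrite s0 mulr0.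
  rewrite -[RHS]E mulr_sumr; apply: eq_bigr => k _.
  rewrite mulrA; congr (_ * _); rewrite /B bw [in RHS](bigD1 k)//=.
  by field; rewrite qw.
have B0 := exponentials_independent Pne eB sumB.
move=> k; have p0 z : p k z = 0.
  apply: contrapT => /eqP pz.
  have [w] : exists w, p k w * \prod_(l <- [seq l <- enum I | l != k]) q l w != 0.
    apply: entire_subexp_integral => //; first exact: entire_subexp_prod; first by exists z.
    exact: entire_subexp_prod_neq0.
  by rewrite big_filter big_enum_cond /= -/(B k w) B0 eqxx.
by move=> z0; apply: near1 (bpq k z0) => z ->; rewrite p0 mul0r.
Qed.

End MeromorphicQuotients.

(** * Linear changes of variables in polynomials *)

Section LinearForms.
Variable S : comNzRingType.

Definition linear_forms r (g : 'M[S]_r) : r.-tuple (mpoly r S) :=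
  [tuple \sum_k g j k *: mpolyX S (mnm1 k) | j < r].

Lemma tnth_linear_forms r (g : 'M[S]_r) j : tnth (linear_forms g) j =
  \sum_k g j k *: mpolyX S (mnm1 k).
Proof. exact: tnth_mktuple. Qed.

Lemma meval_linear_forms r (g : 'M[S]_r) (f : 'I_r -> S) (p : mpoly r S) :
  meval f (comp_mpoly (linear_forms g) p) = meval (fun j => \sum_k g j k * f k) p.
Proof.
rewrite comp_mpoly_meval; apply: meval_eq => j; rewrite tnth_linear_forms.
by rewrite raddf_sum; apply: eq_bigr => k _; rewrite /= mevalZ mevalXU.
Qed.

Lemma comp_mpolyE n k (lq : n.-tuple (mpoly k S)) (p : mpoly n S) :
  comp_mpoly lq p =
  \sum_(m <- msupp p) mpolyC k (mcoeff m p) * \prod_(i < n) tnth lq i ^+ m i.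
Proof. by []. Qed.

Lemma comp_linear_forms r (g g' : 'M[S]_r) (p : mpoly r S) :
  comp_mpoly (linear_forms g') (comp_mpoly (linear_forms g) p) =
  comp_mpoly (linear_forms (g *m g')) p.
Proof.
have tE j : comp_mpoly (linear_forms g') (tnth (linear_forms g) j) =
    tnth (linear_forms (g *m g')) j.
  rewrite !tnth_linear_forms (raddf_sum (comp_mpoly (linear_forms g'))) /=.
  under eq_bigr do rewrite comp_mpolyZ comp_mpolyXU -tnth_nth tnth_linear_forms scaler_sumr.
  rewrite exchange_big /=; apply: eq_bigr => k _.
  rewrite mxE scaler_suml; apply: eq_bigr => l _; by rewrite scalerA.
rewrite [in LHS](comp_mpolyE (linear_forms g)) [in RHS]comp_mpolyE raddf_sum /=.
apply: eq_bigr => m _; rewrite rmorphM /= comp_mpolyC; congr (_ * _).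
by rewrite rmorph_prod /=; apply: eq_bigr => i _; rewrite rmorphXn /= tE.
Qed.

Lemma mcoeff_comp_scalar r (c : S) (p : mpoly r S) m :
  mcoeff m (comp_mpoly (linear_forms c%:M) p) = mcoeff m p * c ^+ mdeg m.
Proof.
have tE (j : 'I_r) : tnth (linear_forms c%:M) j = c *: mpolyX S (mnm1 j).
  rewrite tnth_linear_forms (bigD1 j)//= mxE eqxx big1 ?addr0// => k kj.
  by rewrite mxE eq_sym (negPf kj) scale0r.
have mE (m' : multinom r) : \prod_(i < r) tnth (linear_forms c%:M) i ^+ m' i =
    c ^+ mdeg m' *: mpolyX S m'.
  under eq_bigr do rewrite tE exprZn.
  rewrite scaler_prod mpolyXE_id; congr (_ *: _).
  by rewrite mdegE -prodrXr.
rewrite comp_mpolyE raddf_sum /=.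
under eq_bigr do rewrite mE mcoeffCM mcoeffZ mcoeffX.
have [mp|mp] := boolP (m \in msupp p).
  rewrite (bigD1_seq m) ?msupp_uniq//= eqxx mulr1 big1 ?addr0// => m' m'm.
  by rewrite (negPf m'm) !mulr0.
rewrite (memN_msupp_eq0 mp) mul0r big_seq big1// => m' m'p.
have [m'm|_] := eqVneq m' m; last by rewrite !mulr0.
by rewrite m'm (negPf mp) in m'p.
Qed.

End LinearForms.

Section LinearChange.
Variable R : realType.
Local Notation C := (Cplx R).
Implicit Types (F G : C -> C) (z w : C).

Lemma fct_prodE (I : Type) (s : seq I) (Q : pred I) (F : I -> C -> C) z :
  (\prod_(i <- s | Q i) F i) z = \prod_(i <- s | Q i) F i z.
Proof. exact: (big_morph (fun f : C -> C => f z)). Qed.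

Lemma fct_expE F n z : (F ^+ n) z = F z ^+ n.
Proof. by elim: n => [|n IH]; rewrite ?expr0// !exprS -IH. Qed.

Lemma fct_detE r (g : 'I_r -> 'I_r -> C -> C) z :
  (\det (\matrix_(j < r, k < r) g j k)) z = \det (\matrix_(j < r, k < r) g j k z).
Proof.
rewrite /determinant fct_sumE; apply: eq_bigr => s _.
rewrite fctE fct_expE; congr (_ * _).
by rewrite fct_prodE; apply: eq_bigr => i _; rewrite !mxE.
Qed.

Lemma mero_subexp_det r (g : 'I_r -> 'I_r -> C -> C) :
  (forall j k, mero_subexp (g j k)) ->
  mero_subexp (fun z => \det (\matrix_(j < r, k < r) g j k z)).
Proof.
move=> mg; apply: mero_subexp_sum => s; apply: mero_subexpM; first exact: mero_subexp_cst.
under eq_fun do under eq_bigr do rewrite mxE.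
by apply: mero_subexp_prod.
Qed.

Lemma not_mero_eq0 F (A : set C) : nondiscrete A -> (forall z, A z -> F z != 0) ->
  ~ mero_eq F 0.
Proof.
move=> [z0 hz0] hF F0.
have [y [yz0 Ay /(_ yz0)]] := hz0 _ (F0 z0).
by move/eqP; apply/negP; exact: hF.
Qed.

Lemma vanishing_row r (a : 'I_r -> C) (B : 'M[C]_r) : \det B != 0 ->
  (forall k, \sum_j a j * B j k = 0) -> forall j, a j = 0.
Proof.
move=> dB ha j.
have uB : B \in unitmx by rewrite unitmxE unitfE.
have aB : (\row_j a j) *m B = 0.
  by apply/rowP => k; rewrite !mxE -[RHS](ha k); apply: eq_bigr => i _; rewrite mxE.
have : \row_j a j = 0 by rewrite -[LHS](mulmxK uB) aB mul0mx.
by move/rowP/(_ j); rewrite !mxE.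
Qed.

Lemma mcoeff_comp_eq0 r (lq : r.-tuple (mpoly r (C -> C))) (p : mpoly r (C -> C)) z m :
  (forall m, mcoeff m p z = 0) -> mcoeff m (comp_mpoly lq p) z = 0.
Proof.
move=> p0; rewrite comp_mpolyE raddf_sum /= fct_sumE big1// => m' _.
by rewrite mcoeffCM fctE p0 mul0r.
Qed.

(** The adjugate matrix inverts the change of variables up to the determinant D:
    substituting it turns the coefficient p_m into p_m D^|m|. *)
Lemma mcoeff_linear_change_eq0 r (g : 'I_r -> 'I_r -> C -> C) (p : mpoly r (C -> C)) z :
  \det (\matrix_(j < r, k < r) g j k z) != 0 ->
  (forall m, mcoeff m
    (comp_mpoly (linear_forms (\matrix_(j < r, k < r) g j k)) p) z = 0) ->
  forall m, mcoeff m p z = 0.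
Proof.
set M := (\matrix_(j < r, k < r) g j k) => D0 h m.
have := mcoeff_comp_eq0 (linear_forms (\adj M)) m h.
rewrite comp_linear_forms mul_mx_adj mcoeff_comp_scalar fctE fct_expE fct_detE.
by move/eqP; rewrite mulf_eq0 expf_eq0 (negPf D0) andbF orbF => /eqP.
Qed.

Section MquotCoefficients.
Let S := [pred F : C -> C | `[< mero_subexp F >]].
Let S_closed : subring_closed S.
Proof.
split; first by apply/asboolP; exact: mero_subexp_cst.
- move=> F G /asboolP mF /asboolP mG; apply/asboolP.
  have := mero_subexpD mF (mero_subexpM (mero_subexp_cst (-1)) mG); congr mero_subexp.
  by apply/funext => z; rewrite mulN1r.
- by move=> F G /asboolP mF /asboolP mG; apply/asboolP; exact: mero_subexpM.
Qed.
HB.instance Definition _ := GRing.isSubringClosed.Build (C -> C) S S_closed.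

Lemma mero_subexp_comp_linear_forms r (g : 'M[C -> C]_r) (p : mpoly r (C -> C)) :
  (forall j k, mero_subexp (g j k)) -> (forall m, mero_subexp (mcoeff m p)) ->
  forall m, mero_subexp (mcoeff m (comp_mpoly (linear_forms g) p)).
Proof.
move=> mg mp m; apply/asboolP; rewrite -[asbool _]/(mcoeff m _ \in S).
suff /mpolyOverP : comp_mpoly (linear_forms g) p \is a mpolyOver r S by exact.
rewrite comp_mpolyE; apply: rpred_sum => m' _; apply: rpredM.
  by rewrite mpolyOverC; apply/asboolP.
apply: rpred_prod => j _; apply: rpredX; rewrite tnth_linear_forms.
apply: rpred_sum => k _; apply: mpolyOverZ; first by apply/asboolP; exact: mg.
exact: mpolyOverX.
Qed.
End MquotCoefficients.

End LinearChange.

(** * The theorem *)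

(** Of the summands present, the one of largest degree cannot cancel. *)
Lemma size_sum_distinct_degrees (K : idomainType) r (P : 'I_r -> {poly K})
    (c : 'I_r -> K) :
  (forall j, 1 <= (size (P j)).-1)%N -> injective (fun j => (size (P j)).-1) ->
  (exists i, c i != 0) -> (1 < size (\sum_i c i *: P i)%R)%N.
Proof.
move=> d1 dinj [i0 ci0].
have [i ci imax] := @arg_maxnP _ i0 (fun i => c i != 0) (fun i => (size (P i)).-1) ci0.
have Pi0 : P i != 0 by apply: contraTneq (d1 i) => ->; rewrite size_poly0.
apply: (leq_ltn_trans (d1 i)); rewrite ltnNge; apply/negP => /leq_sizeP /(_ _ (leqnn _)).
rewrite coef_sum (bigD1 i)//= coefZ big1 ?addr0 => [|j ji].
  by apply/eqP; rewrite mulf_neq0// -lead_coefE lead_coef_eq0.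
rewrite coefZ; have [->|cj] := eqVneq (c j) 0; first by rewrite mul0r.
rewrite nth_default ?mulr0//.
have : ((size (P j)).-1 < (size (P i)).-1)%N.
  by rewrite ltn_neqAle (inj_eq dinj) ji; exact: imax.
by case: (size (P j)).
Qed.

Theorem corollary3p4 (R : realType) (r : nat) (r_ge1 : (1 <= r)%N)
  (P : 'I_r -> {poly Cplx R})
  (P_sub : forall j k, j != k -> (1 < size (P j - P k)%R)%N)
  (d : 'I_r -> nat) (d_def : forall j, d j = (size (P j)).-1)
  (f : 'I_r -> Cplx R -> Cplx R) (f_def : forall j z, f j z = cexp (P j).[z])
  (g : 'I_r -> 'I_r -> Cplx R -> Cplx R) (g_lt1 : forall j k, mero_lt1 (g j k))
  (A : set (Cplx R)) (A_nondiscrete : nondiscrete A)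
  (D_neq0 : forall z, A z -> \det (\matrix_(j < r, k < r) g j k z) != 0)
  (h : 'I_r -> Cplx R -> Cplx R)
  (h_def : forall j, h j = \sum_(k < r) g j k * f k) :
  lin_indep_mero_lt1 h /\
  ((forall j, (1 <= d j)%N) -> injective d -> alg_indep_mero_lt1 h).
Proof.
have mg j k := mero_subexp_of_lt1 (g_lt1 j k).
have det_ne0 := mero_subexp_isolated_zeros (mero_subexp_det mg)
  (not_mero_eq0 A_nondiscrete D_neq0).
split.
- move=> a a_lt1 ah0.
  have ma j := mero_subexp_of_lt1 (a_lt1 j).
  pose b k z := \sum_j a j z * g j k z.
  have mb k : mero_subexp (b k) by apply: mero_subexp_sum => j; apply: mero_subexpM.
  have b0 : forall k, mero_eq (b k) 0.
    apply: (mero_subexp_exponentials_independent P_sub mb) => z0.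
    apply: near1 (ah0 z0) => z; rewrite fct_sumE => E; rewrite -[RHS]E.
    under eq_bigr do rewrite /b mulr_suml.
    rewrite exchange_big /=; apply: eq_bigr => j _.
    rewrite fctE h_def fct_sumE mulr_sumr; apply: eq_bigr => k _.
    by rewrite fctE f_def mulrA.
  move=> j z0; apply: (near2 _ (near_all (fun k => b0 k z0)) (det_ne0 z0)) => z bz dz.
  apply: (vanishing_row (a := fun j => a j z) dz) => k; rewrite -[RHS](bz k).
  by apply: eq_bigr => i _; rewrite mxE.
- move=> d1 dinj p p_lt1 ph0.
  pose M : 'M[Cplx R -> Cplx R]_r := \matrix_(j < r, k < r) g j k.
  pose e := comp_mpoly (linear_forms M) p.
  have me : forall m, mero_subexp (mcoeff m e).
    apply: mero_subexp_comp_linear_forms => [j k|m]; first by rewrite mxE.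
    exact: mero_subexp_of_lt1.
  have hE : h = (fun j => \sum_k M j k * f k).
    by apply/funext => j; rewrite h_def; apply: eq_bigr => k _; rewrite mxE.
  have ef0 : mero_eq (meval f e) 0 by rewrite meval_linear_forms -hE.
  pose N := mmeasure mdeg e.
  pose Pm (m : bmultinom r N) := \sum_i (m i)%:R *: P i.
  have Pm_sub m m' : m != m' -> (1 < size (Pm m - Pm m')%R)%N.
    move=> mm'; have -> : Pm m - Pm m' = \sum_i ((m i)%:R - (m' i)%:R) *: P i.
      by rewrite /Pm -sumrB; apply: eq_bigr => i _; rewrite scalerBl.
    apply: size_sum_distinct_degrees => [j||].
    + by rewrite -d_def.
    + by move=> j k; rewrite -!d_def; exact: dinj.
    apply: contrapT => hm; move/eqP: mm'; apply; apply/val_inj/mnmP => i.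
    apply/eqP; apply: contrapT => mi; apply: hm; exists i.
    by rewrite subr_eq0 eqr_nat; apply/negP.
  have e0 (m : bmultinom r N) : mero_eq (mcoeff m e) 0.
    move: m; apply: (mero_subexp_exponentials_independent (P := Pm) Pm_sub).
      by move=> m; exact: me.
    move=> z0.
    apply: near1 (ef0 z0) => z E; rewrite -[RHS]E.
    rewrite /meval (@mmapE _ _ _ _ _ _ N)// fct_sumE; apply: eq_bigr => m _.
    rewrite fctE; congr (_ * _); rewrite /mmap1 fct_prodE /Pm horner_sum cexp_sum.
    apply: eq_bigr => i _; rewrite fct_expE f_def hornerZ -cexpMn.
    by rewrite mulr_natl.
  move=> m z0; apply: (near2 _ (near_all (fun m => e0 m z0)) (det_ne0 z0)) => z ez dz.
  apply: (mcoeff_linear_change_eq0 (p := p) dz) => m'.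
  have [m'e|m'e] := boolP (m' \in msupp e); last by rewrite (memN_msupp_eq0 m'e).
  exact: (ez (BMultinom (msize_mdeg_lt m'e))).
Qed.
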